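(* Let $(A=KQ/\mathcal I,\le)$ be a 1-quasi-hereditary algebra whose Ringel dual $(R(A),\ge)$ is also 1-quasi-hereditary, and let the elements $\mathfrak t(i,k)\in P(1)_k$ ($i,k\in Q_0$, $k\le i$) be as defined in the context. Then: (1) the set $\{\mathfrak t(i,k)\mid i\in Q_0,\ k\in Q_0,\ k\le i\}$ is a $K$-basis of $P(1)$; (2) $\{A\cdot\mathfrak t(i,k)\mid i,k\in Q_0,\ k\le i\}$ equals the set of local submodules of $P(1)$ belonging to $\mathfrak F(\Delta)$; moreover, for every $j\in Q_0$, every local submodule of $P(j)$ belonging to $\mathfrak F(\Delta)$ is isomorphic to $A\cdot\mathfrak t(i,k)$ for some $i,k$ with $k\le i$; (3) for every $F\in\mathrm{End}_A(P(1))$ and all $i,k\in Q_0$ with $k\le i$, $F(A\cdot\mathfrak t(i,k))\subseteq A\cdot\mathfrak t(i,k)$.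
   Context: $K$ is an algebraically closed field; $A=KQ/\mathcal I$ is a finite-dimensional basic $K$-algebra given by quiver $Q$ and relations, with vertex set $Q_0=\{1,\dots,n\}$; modules are finite-dimensional left modules; a module is local if its top is simple. For $i\in Q_0$, $e_i$ is the trivial path, $P(i)=Ae_i$, $I(i)$, $S(i)$ the indecomposable projective, injective, simple modules; for a module $M$, $M_k=e_kM$ and $[M:S(k)]=\dim_K M_k$. Product convention: for arrows $\beta:a\to b$, $\alpha:b\to c$ the path $a\to b\to c$ is $\alpha\cdot\beta$; so a path from $a$ to $b$ lies in $e_bAe_a=P(a)_b$. Given a partial order $\le$ on $Q_0$: the standard module $\Delta(i)$ is the largest factor module of $P(i)$ with $[\Delta(i):S(k)]=0$ for all $k\not\le i$; the costandard module $\nabla(i)$ is the largest submodule of $I(i)$ with $[\nabla(i):S(k)]=0$ for all $k\not\le i$; $\mathfrak F(\Delta)$ (resp. $\mathfrak F(\nabla)$) is the class of modules with a filtration whose subquotients are standard (resp. costandard) modules, and $(M:\Delta(i))$ is the number of subquotients isomorphic to $\Delta(i)$. $(A,\le)$ is quasi-hereditary if for all $i,k$: $[\Delta(i):S(i)]=1$, $P(i)\in\mathfrak F(\Delta)$, $(P(i):\Delta(k))=0$ for $k\not\le i$, $(P(i):\Delta(i))=1$. A quasi-hereditary $(A,\le)$ is 1-quasi-hereditary if: (1) $\le$ has a smallest and a largest element, denoted $1$ and $n$; (2) $[\Delta(i):S(j)]=(P(j):\Delta(i))=1$ whenever $j\le i$; (3) $\mathrm{soc}\,P(i)\cong\mathrm{top}\,I(i)\cong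 S(1)$ for all $i$; (4) for all $i$ there exist a monomorphism $\Delta(i)\hookrightarrow\Delta(n)$ and an epimorphism $\nabla(n)\twoheadrightarrow\nabla(i)$. For quasi-hereditary $(A,\le)$ and $i\in Q_0$, $T(i)$ is the (unique up to isomorphism) indecomposable module in $\mathfrak F(\Delta)\cap\mathfrak F(\nabla)$ with $[T(i):S(i)]=1$ and $[T(i):S(j)]=0$ for $j\not\le i$; the Ringel dual is $R(A)=\mathrm{End}_A(\bigoplus_iT(i))^{op}$ with the opposite order $\ge$. Write $a\lhd b$ if $a<b$ and no $l$ satisfies $a<l<b$; for 1-quasi-hereditary $A$, $Q$ has exactly one arrow in each direction between $a$ and $b$ when $a\lhd b$ and no other arrows. For $k\in Q_0$ fix a path $p(1,k,k)$ from $1$ to $k$ through vertices $1=\lambda_0\lhd\lambda_1\lhd\dots\lhd\lambda_r=k$ (with $p(1,1,1)=e_1$). Elements $\mathfrak t(i,k)$: when $A$ and $R(A)$ are 1-quasi-hereditary, for each $i\in Q_0$ there exists $\mathfrak t(i,1)\in P(1)_1=e_1Ae_1$ with $A\cdot\mathfrak t(i,1)\cong T(i)$; fix such an element for each $i$, and for $k\le i$ set $\mathfrak t(i,k):=p(1,k,k)\cdot\mathfrak t(i,1)\in P(1)_k$.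
   Formalization: In the definition of quasi-hereditary, ''(P(i):Δ(k))=0 for k≰i'' is read in the standard way as ''(P(i):Δ(k))=0 unless i≤k'', since the literal condition contradicts (P(j):Δ(i))=1 for j≤i as soon as there are two vertices. *)

(* Defs.v *)
(* Finite-dimensional algebras are represented concretely as
   unital subalgebras of a matrix algebra 'M[K]_N (every finite-dimensional
   algebra is of this form via its regular representation); modules are
   matrix representations in the ROW-VECTOR convention: an element X acts on a
   row vector u by  u *m mact M X, so left modules are anti-multiplicative. *)
From HB Require Import structures.
From mathcomp Require Import all_boot all_order all_algebra.
Set Implicit Arguments.
Unset Strict Implicit.
Unset Printing Implicit Defensive.
Import GRing.Theory.
Local Open Scope ring_scope.

Section FDAlg.
Variable K : fieldType.
Variable N : nat.

(* An algebra A is encoded by a row space R : 'M_(N*N); X is in A iff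
   mxvec X lies in the row space of R. *)
Definition inA (R : 'M[K]_(N * N)) (X : 'M[K]_N) : Prop := (mxvec X <= R)%MS.

Record amod := AMod { mdim : nat; mact : 'M[K]_N -> 'M[K]_mdim }.

Variable R : 'M[K]_(N * N).

Definition subalg : Prop :=
  inA R 1%:M /\ forall X Y, inA R X -> inA R Y -> inA R (X *m Y).

(* M is a left A-module (row convention: anti-multiplicative) *)
Definition is_lmod (M : amod) : Prop :=
  mact M 1%:M = 1%:M /\
  (forall X Y, inA R X -> inA R Y -> mact M (X *m Y) = mact M Y *m mact M X) /\
  (forall (c : K) X Y, inA R X -> inA R Y ->
      mact M (c *: X + Y) = c *: mact M X + mact M Y).

(* the left regular module sits inside Mat: A acts on 'M_N by left mult. *)
Definition Mat : amod := @AMod (N * N) (fun X => lin_mulmx X).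
(* the dual of the right module 'M_N (A acting by right multiplication) *)
Definition DMat : amod := @AMod (N * N) (fun X => (lin_mulmxr X : 'M_(N * N))^T).

Definition mulsp (U V : 'M[K]_(N * N)) : 'M[K]_(N * N) :=
  (\sum_(i < N * N) \sum_(j < N * N)
      <<mxvec (vec_mx (row i U) *m vec_mx (row j V))>>)%MS.
Definition powsp (J : 'M[K]_(N * N)) (m : nat) := iter m (mulsp J) J.

Section Idem.
Variable n : nat.
Variable e : 'I_n -> 'M[K]_N.

(* J is a nilpotent two-sided ideal with A = (+)_i K e_i (+) J;
   then J is the Jacobson radical and A/J = K^n (A basic). *)
Definition rad_decomp (J : 'M[K]_(N * N)) : Prop :=
  (J <= R)%MS /\
  (forall X Y, inA R X -> inA J Y -> inA J (X *m Y) /\ inA J (Y *m X)) /\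
  (exists m, (powsp J m == (0 : 'M[K]_(N * N)))%MS) /\
  (R == (\sum_(i < n) <<mxvec (e i)>>) + J)%MS /\
  ((\sum_(i < n) <<mxvec (e i)>>) :&: J == (0 : 'M[K]_(N * N)))%MS.

(* A basic algebra with complete set of primitive orthogonal idempotents e_i
   (the trivial paths of a presentation A = KQ/I). *)
Definition basic_alg : Prop :=
  subalg /\
  (forall i, inA R (e i) /\ e i != 0) /\
  (forall i j, e i *m e j = if i == j then e i else 0) /\
  (\sum_(i < n) e i = 1%:M) /\
  (exists J, rad_decomp J).

Definition arrow (J : 'M[K]_(N * N)) (a b : 'I_n) (al : 'M[K]_N) : Prop :=
  inA J al /\ e b *m al *m e a = al /\ ~ inA (mulsp J J) al.

Local Unset Implicit Arguments.
Section Mod.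
Variable M : amod.

Definition submod (U : 'M[K]_(mdim M)) : Prop :=
  forall X, inA R X -> (U *m mact M X <= U)%MS.

(* [U/W : S(k)] = dim e_k (U/W) *)
Definition mult (U W : 'M[K]_(mdim M)) (k : 'I_n) : nat :=
  (\rank (U *m mact M (e k)) - \rank (W *m mact M (e k)))%N.

Definition simple_sq (U W : 'M[K]_(mdim M)) : Prop :=
  (W < U)%MS /\
  forall V, submod V -> (W <= V)%MS -> (V <= U)%MS -> (V == W)%MS \/ (V == U)%MS.

(* U/W is isomorphic to the simple module S(k) (one-dimensional, e_k acting
   as the identity) *)
Definition iso_S (U W : 'M[K]_(mdim M)) (k : 'I_n) : Prop :=
  (\rank U - \rank W)%N = 1%N /\ mult U W k = 1%N.

Definition local_sq (U W : 'M[K]_(mdim M)) : Prop :=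
  exists V, submod V /\ (W <= V)%MS /\ simple_sq U V /\
   forall V', submod V' -> (W <= V')%MS -> simple_sq U V' -> (V' == V)%MS.

Definition top_iso_S (U W : 'M[K]_(mdim M)) (k : 'I_n) : Prop :=
  exists V, submod V /\ (W <= V)%MS /\ iso_S U V k /\
   forall V', submod V' -> (W <= V')%MS -> simple_sq U V' -> (V' == V)%MS.

Definition soc_iso_S (U W : 'M[K]_(mdim M)) (k : 'I_n) : Prop :=
  exists V, submod V /\ (W <= V)%MS /\ (V <= U)%MS /\ iso_S V W k /\
   forall V', submod V' -> (V' <= U)%MS -> simple_sq V' W -> (V' <= V)%MS.

Definition indecomp (U W : 'M[K]_(mdim M)) : Prop :=
  (W < U)%MS /\
  ~ exists V1 V2, [/\ submod V1 /\ submod V2, (W < V1)%MS, (W < V2)%MS,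
        (V1 + V2 == U)%MS & (V1 :&: V2 == W)%MS].
End Mod.
Local Set Implicit Arguments.

(* isomorphism between the subquotient U1/W1 of M1 and U2/W2 of M2:
   f : U1 -> U2/W2 surjective, A-linear, with kernel W1 *)
Local Unset Implicit Arguments.
Definition iso (M1 : amod) (U1 W1 : 'M[K]_(mdim M1))
               (M2 : amod) (U2 W2 : 'M[K]_(mdim M2)) : Prop :=
  exists f : 'M[K]_(mdim M1, mdim M2),
    [/\ (U1 *m f + W2 == U2)%MS,
        (U1 :&: kermx (f *m cokermx W2) == W1)%MS &
        forall X, inA R X ->
          (U1 *m (mact M1 X *m f - f *m mact M2 X) <= W2)%MS].

Variable le : rel 'I_n.

Definition Pmx (i : 'I_n) : 'M[K]_(N * N) := R *m lin_mulmxr (e i).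
Definition Prmx (i : 'I_n) : 'M[K]_(N * N) := R *m lin_mulmx (e i).
(* I(i) = D(e_i A) = DMat / (e_i A)^perp *)
Definition Iker (i : 'I_n) : 'M[K]_(N * N) := kermx (Prmx i)^T.

(* Delta(i) = P(i)/W, W the smallest submodule with no composition factors
   S(k), k not <= i, in P(i)/W  (largest such factor module) *)
Definition DeltaKer (i : 'I_n) (W : 'M[K]_(N * N)) : Prop :=
  [/\ submod Mat W, (W <= Pmx i)%MS,
      (forall k, ~~ le k i -> mult Mat (Pmx i) W k = 0%N) &
      forall W', submod Mat W' -> (W' <= Pmx i)%MS ->
        (forall k, ~~ le k i -> mult Mat (Pmx i) W' k = 0%N) -> (W <= W')%MS].

(* nabla(i) = V/Iker i, the largest submodule of I(i) with no composition
   factors S(k), k not <= i *)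
Definition NablaSub (i : 'I_n) (V : 'M[K]_(N * N)) : Prop :=
  [/\ submod DMat V, (Iker i <= V)%MS,
      (forall k, ~~ le k i -> mult DMat V (Iker i) k = 0%N) &
      forall V', submod DMat V' -> (Iker i <= V')%MS ->
        (forall k, ~~ le k i -> mult DMat V' (Iker i) k = 0%N) -> (V' <= V)%MS].

Definition iso_Delta (M : amod) (U W : 'M[K]_(mdim M)) (i : 'I_n) : Prop :=
  exists D, DeltaKer i D /\ iso M U W Mat (Pmx i) D.
Definition iso_Nabla (M : amod) (U W : 'M[K]_(mdim M)) (i : 'I_n) : Prop :=
  exists V, NablaSub i V /\ iso M U W DMat V (Iker i).

Definition filt (isoX : forall M : amod, 'M[K]_(mdim M) -> 'M[K]_(mdim M) -> 'I_n -> Prop)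
  (M : amod) (U W : 'M[K]_(mdim M)) (t : nat) (c : nat -> 'M[K]_(mdim M))
  (lab : nat -> 'I_n) : Prop :=
  [/\ (c 0%N == W)%MS, (c t == U)%MS, (forall s, submod M (c s)) &
      forall s, (s < t)%N -> (c s <= c s.+1)%MS /\ isoX M (c s.+1) (c s) (lab s)].

Definition inF isoX (M : amod) (U W : 'M[K]_(mdim M)) : Prop :=
  exists t c lab, filt isoX M U W t c lab.

(* (U/W : Delta(i)) = m : the number of subquotients isomorphic to Delta(i)
   in a Delta-filtration (an invariant) *)
Definition Dfmult (M : amod) (U W : 'M[K]_(mdim M)) (i : 'I_n) (m : nat) : Prop :=
  forall t c lab, filt iso_Delta M U W t c lab ->
    count (fun s => lab s == i) (iota 0 t) = m.

Definition Dmult (i k : 'I_n) (m : nat) : Prop :=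
  exists D, DeltaKer i D /\ mult Mat (Pmx i) D k = m.

Definition partial_order : Prop :=
  reflexive le /\ antisymmetric le /\ transitive le.

Definition quasi_hered : Prop :=
  partial_order /\
  forall i,
   [/\ Dmult i i 1%N, inF iso_Delta Mat (Pmx i) 0,
       (forall k, ~~ le i k -> Dfmult Mat (Pmx i) 0 k 0%N) &
       Dfmult Mat (Pmx i) 0 i 1%N].

Definition one_qh (bot top : 'I_n) : Prop :=
  [/\ basic_alg /\ quasi_hered,
      (forall i, le bot i /\ le i top),
      (forall i j, le j i -> Dmult i j 1%N /\ Dfmult Mat (Pmx j) 0 i 1%N),
      (forall i, soc_iso_S Mat (Pmx i) 0 bot /\
                 top_iso_S DMat 1%:M (Iker i) bot) &
      (forall i,
        (exists Dn V Di, [/\ DeltaKer top Dn /\ submod Mat V, (Dn <= V)%MS,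
                             (V <= Pmx top)%MS, DeltaKer i Di &
                             iso Mat V Dn Mat (Pmx i) Di]) /\
        (exists Vn V' Vi, [/\ NablaSub top Vn /\ submod DMat V', (Iker top <= V')%MS,
                             (V' <= Vn)%MS, NablaSub i Vi &
                             iso DMat Vn V' DMat Vi (Iker i)]))].

Definition is_tilting (M : amod) (U W : 'M[K]_(mdim M)) (i : 'I_n) : Prop :=
  [/\ inF iso_Delta M U W, inF iso_Nabla M U W, indecomp M U W,
      mult M U W i = 1%N & forall j, ~~ le j i -> mult M U W j = 0%N].

Definition covers (a b : 'I_n) : bool :=
  [&& le a b, a != b & [forall l, ~~ [&& le a l, le l b, l != a & l != b]]].

Definition pathmx (bot : 'I_n) (als : seq 'M[K]_N) : 'M[K]_N :=
  foldl (fun p a => a *m p) (e bot) als.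

Definition Amul (t : 'M[K]_N) : 'M[K]_(N * N) := R *m lin_mulmxr t.
Local Set Implicit Arguments.
End Idem.
End FDAlg.

(* Ringel dual:  R(A) = End_A(T)^op, T = (+)_i T_i.  In the row convention an
   endomorphism is u |-> u *m f, and the product of End_A(T)^op is matrix
   multiplication f *m g. *)
Section Ringel.
Variables (K : fieldType) (N n : nat) (R : 'M[K]_(N * N)).
Variable T : 'I_n -> amod K N.

Definition sumT : amod K N :=
  @AMod K N (\sum_(i < n) mdim (T i))%N (fun X => \mxdiag_(i < n) mact (T i) X).

Definition ringel_alg : 'M[K]_(mdim sumT * mdim sumT) :=
  (\bigcap_(j < N * N)
     kermx (lin_mx (fun f : 'M[K]_(mdim sumT) =>
        mact sumT (vec_mx (row j R)) *m f - f *m mact sumT (vec_mx (row j R)))))%MS.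

Definition ringel_idem (i : 'I_n) : 'M[K]_(mdim sumT) :=
  \mxdiag_(j < n) (if j == i then 1%:M else 0 : 'M[K]_(mdim (T j))).
End Ringel.

Arguments inA {K N} R X.
Arguments amod K N : clear implicits.
Arguments subalg {K N} R.
Arguments is_lmod {K N} R M.
Arguments Mat {K N}.
Arguments DMat {K N}.
Arguments rad_decomp {K N} R {n} e J.
Arguments basic_alg {K N} R {n} e.
Arguments arrow {K N n} e J a b al.
Arguments submod {K N} R M U.
Arguments local_sq {K N} R M U W.
Arguments iso {K N} R M1 U1 W1 M2 U2 W2.
Arguments Pmx {K N} R {n} e i.
Arguments iso_Delta {K N} R {n} e le M U W i.
Arguments iso_Nabla {K N} R {n} e le M U W i.
Arguments inF {K N} R {n} isoX M U W.
Arguments one_qh {K N} R {n} e le bot top.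
Arguments is_tilting {K N} R {n} e le M U W i.
Arguments covers {n} le a b.
Arguments pathmx {K N n} e bot als.
Arguments Amul {K N} R t.
Arguments ringel_alg {K N n} R T.
Arguments ringel_idem {K N n} T i.

(* Main.v *)
(* For an up-set [U] of vertices let [I_U] be the ideal generated by the [e m], [m] in [U].
   The Delta-filtrations of the projectives show that each corner [e b *m A *m e a] has a basis
   of products [yy m b *m xx m a], one for each [m] above [a] and [b], where [xx m a] and
   [yy m b] span the corners at [(m, a)] and [(b, m)] modulo [I_U], [U] = {> m}; moreover the
   basis is compatible with all the [I_U].  By condition (4) and the shape of the arrows, right
   multiplication by the path p(1,k,k) is triangular with nonzero diagonal for these bases.
   Let V_i be the largest submodule of P(1) with all weights [<= i].  As soc P(1) = S(1), pairing
   with [e 1 *m A *m e a] bounds dim e_a V_i by #{m | a <= m <= i}.  Conversely T(i) = A t(i,1)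
   contains, for every [k <= i], a vector of weight [k] killed by all [m] not [<= k]; it can only
   come from a factor nabla(k) of the nabla-filtration, which gives the same lower bound.  Hence
   the annihilator of t(i,1), and then that of t(i,k), is [I_U] with [U] = {not <= i}, and
   A t(i,k) = A e_k V_i.  The latter is invariant under endomorphisms.  A local submodule A u of
   P(j) in F(Delta) has a greatest weight [i], because soc P(j) is simple, and [u] of weight [k]
   has the annihilator of t(i,k). *)
Require Import Defs.
From HB Require Import structures.
From mathcomp Require Import all_boot all_order all_algebra.
Import GRing.Theory.
Local Open Scope ring_scope.
Set Implicit Arguments.
Unset Strict Implicit.
Unset Printing Implicit Defensive.

(** * Linear algebra *)

Section LinearAlgebra.
Variable K : fieldType.

(** The two halves of condition (4) enter separately. The monomorphism makes [yy top b] generate a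
    copy of Delta(b) in P(top) = Delta(top). The epimorphism makes left multiplication by [xx top b]
    kill I_U for U = {not <= b}, so that it reads off a coefficient modulo I_{>b}. An arrow a -> b
    with a < b lies outside J^2, hence has a nonzero coefficient along [xx b a]; this keeps the
    diagonal of the path multiplication nonzero. The obstacle is that the nabla-filtration of T(i)
    comes with unknown multiplicities. That each nabla(k), k <= i, occurs is forced by vectors built
    outside T(i): copies of Delta(k) in P(top) are carried into P(1) by right multiplication with
    [xx top bot], and they fall into T(i) because weight i has dimension at most one in V_i. Once
    the annihilators are known, the basis, the filtrations and the classification follow from three
    properties of t(i,k): its own weight, the weights of A t(i,k), and its annihilator. *)

Lemma memxvec_linear {m p q} (S : 'M[K]_(q, m * p)) (c : K) (X Y : 'M[K]_(m, p)) :
  (mxvec X <= S)%MS -> (mxvec Y <= S)%MS -> (mxvec (c *: X + Y) <= S)%MS.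
Proof. by move=> hX hY; rewrite linearP addmx_sub // scalemx_sub. Qed.

Lemma mem_sum_genmx (I : finType) (P : pred I) m (v : I -> 'rV[K]_m) (x : 'rV_m) :
  reflect (exists g : I -> K, x = \sum_(i | P i) g i *: v i)
    (x <= \sum_(i | P i) <<v i>>)%MS.
Proof.
apply: (iffP sub_sumsmxP) => [[u ->]|[g ->]].
  have h i : exists a, u i *m <<v i>>%MS = a *: v i.
    by apply/sub_rVP; rewrite -(genmxE (v i)) submxMl.
  (* [<<v i>>] spans the same line as [v i] but is another matrix. The coefficient along [v i] is
     recovered by division at a nonzero coordinate; it is set to 0 when [v i] vanishes. *)
  pose g i := if [pick j | P i && (v i 0 j != 0)] is Some j
              then (u i *m <<v i>>%MS) 0 j / v i 0 j else 0.
  exists g; apply: eq_bigr => i Pi; rewrite /g.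
  have [a ->] := h i.
  case: pickP => [j /andP[_ vj]|nj]; first by rewrite !mxE mulfK.
  have -> : v i = 0.
    by apply/rowP => j; move: (nj j); rewrite Pi mxE /= => /negbFE/eqP.
  by rewrite !scaler0.
have h i : exists u : 'rV_m, g i *: v i = u *m <<v i>>%MS.
  by apply/submxP; rewrite genmxE scalemx_sub.
have [u hu] := fin_all_exists h.
by exists u; apply: eq_bigr => i _.
Qed.

Lemma rank_sum_genmx (I : finType) (P : pred I) m (v : I -> 'rV[K]_m) :
  (\rank (\sum_(i | P i) <<v i>>)%MS <= #|P|)%N.
Proof.
rewrite -sum1_card; elim/big_rec2: _ => [|i k S Pi hS]; first by rewrite mxrank0.
rewrite (leq_trans (mxrank_adds_leqif _ _)) // leq_add // genmxE.
exact: rank_leq_row.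
Qed.

Section Families.
Variables (I : finType) (P : pred I) (m : nat) (v : I -> 'rV[K]_m).

Definition independent :=
  forall g : I -> K, \sum_(i | P i) g i *: v i = 0 -> forall i, P i -> g i = 0.

(** Exchange: a vector with nonzero coefficient in a relation could be dropped from the family,
    which would then be too small for the rank of [S]. *)
Lemma spanning_independent q (S : 'M[K]_(q, m)) :
  (forall x : 'rV_m, (x <= S)%MS -> exists g : I -> K, x = \sum_(i | P i) g i *: v i) ->
  (#|P| <= \rank S)%N -> independent.
Proof.
move=> spanS cardS g g0 i Pi; apply/eqP/negPn/negP => gi.
have hS : (S <= \sum_(j | P j && (j != i)) <<v j>>)%MS.
  apply/rV_subP => x /spanS[h ->]; apply/mem_sum_genmx.
  exists (fun j => h j - h i / g i * g j).
  rewrite (bigD1 i) //=.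
  have -> : v i = - (g i)^-1 *: \sum_(j | P j && (j != i)) g j *: v j.
    move: g0; rewrite (bigD1 i) //= => /eqP; rewrite addr_eq0 => /eqP h0.
    by rewrite scaleNr -scalerN -h0 scalerA mulVf // scale1r.
  rewrite scalerA scaler_sumr -big_split /=; apply: eq_bigr => j _.
  by rewrite scalerA -scalerDl addrC mulrN mulNr.
move/mxrankS: hS => /(leq_trans cardS)/leq_trans/(_ (rank_sum_genmx _ _)).
by rewrite (cardD1x Pi) //= ltnn.
Qed.

Lemma independent_rank q (S : 'M[K]_(q, m)) :
  (forall i, P i -> (v i <= S)%MS) -> independent -> (#|P| <= \rank S)%N.
Proof.
move=> vS hind.
pose M := \matrix_(s < #|P|) v (enum_val s).
have Mfree : row_free M.
  apply: inj_row_free => u; rewrite mulmx_sum_row => h.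
  pose g i := if insub (index i (enum P)) is Some s then u 0 s else 0.
  have gE (s : 'I_#|P|) : g (enum_val s) = u 0 s.
    have hs : (s < size (enum P))%N by rewrite -cardE.
    rewrite /g /enum_val index_uniq ?enum_uniq //.
    by rewrite insubT //= => hh; congr (u 0 _); apply: val_inj.
  apply/rowP => s; rewrite mxE -gE; apply: hind; last exact: enum_valP.
  rewrite (big_enum_val (A := P)) -[RHS]h /=.
  by apply: eq_bigr => r _; rewrite gE rowK.
rewrite -(eqP Mfree); apply: mxrankS; apply/row_subP => s.
by rewrite rowK vS //; exact: enum_valP.
Qed.

Lemma independent_spanning q (S : 'M[K]_(q, m)) :
  (forall i, P i -> (v i <= S)%MS) -> independent -> (\rank S <= #|P|)%N ->
  forall x : 'rV_m, (x <= S)%MS -> exists g : I -> K, x = \sum_(i | P i) g i *: v i.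
Proof.
move=> vS hind hr x xS; apply/mem_sum_genmx.
have hle : (\sum_(i | P i) <<v i>> <= S)%MS.
  by apply/sumsmx_subP => i Pi; rewrite genmxE vS.
apply: submx_trans xS _; have /mxrank_leqif_sup := hle => /geq_leqif <-.
apply: (leq_trans hr); apply: independent_rank hind => i Pi.
by apply: (submx_trans _ (sumsmx_sup i _ (submx_refl _))); rewrite ?genmxE.
Qed.

End Families.

Lemma corank1_complement m q r (U : 'M[K]_(q, m)) (W : 'M[K]_(r, m)) :
  (W <= U)%MS -> (\rank U - \rank W <= 1)%N ->
  exists2 y : 'rV_m, (y <= U)%MS &
    forall z : 'rV_m, (z <= U)%MS -> exists c, (z - c *: y <= W)%MS.
Proof.
move=> WU hr; case: (boolP (U <= W)%MS) => [UW|/row_subPn[i hi]].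
  by exists 0 => [|z zU]; rewrite ?sub0mx //; exists 0; rewrite scaler0 subr0 (submx_trans zU).
exists (row i U); first exact: row_sub.
have hsub : (W + row i U <= U)%MS by rewrite addsmx_sub WU row_sub.
have hlt : (W < W + row i U)%MS by rewrite /ltmx addsmxSl addsmx_sub submx_refl.
have : (U <= W + row i U)%MS.
  have /mxrank_leqif_sup := hsub => /geq_leqif <-.
  by rewrite (leq_trans _ (rank_ltmx hlt)) //; move: hr; rewrite leq_subLR addn1.
move=> UWy z zU; have /sub_addsmxP[[a b] ->] := submx_trans zU UWy.
have [c ->] : exists c, b *m row i U = c *: row i U.
  by apply/sub_rVP; rewrite submxMl.
by exists c; rewrite addrK submxMl.
Qed.

(** Distinct labels sit at distinct steps, and each step where the image under [E] grows adds at
    least one to the rank. With [E] the action of an idempotent this counts the factors of a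
    filtration that have a given weight. *)
Lemma chain_rank (I : finType) (P : pred I) m (c : nat -> 'M[K]_m) (E : 'M[K]_m)
    (lab : nat -> I) (t : nat) :
  (forall s, (s < t)%N -> (c s <= c s.+1)%MS) ->
  (forall i, P i -> exists s, [/\ (s < t)%N, lab s = i &
      ~~ (c s.+1 *m E <= c s *m E)%MS]) ->
  (#|P| <= \rank (c t *m E))%N.
Proof.
move=> cS hP.
pose strict s := ~~ (c s.+1 *m E <= c s *m E)%MS.
have h1 k : (k <= t)%N -> (count strict (iota 0 k) <= \rank (c k *m E))%N.
  elim: k => [//|k IH] hk.
  rewrite -addn1 iotaD count_cat /= add0n addn0 addn1.
  have hle : (c k *m E <= c k.+1 *m E)%MS by rewrite submxMr ?cS.
  have IH' := IH (ltnW hk).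
  case: (boolP (strict k)) => hs; last first.
    by rewrite addn0 (leq_trans IH') // mxrankS.
  by rewrite addn1 (leq_ltn_trans IH') // rank_ltmx // /ltmx hle.
apply: leq_trans (h1 t (leqnn t)).
rewrite -size_filter -(size_map lab) (leq_trans _ (card_size _)) //.
apply: subset_leq_card; apply/subsetP => i Pi.
have [s [st <- hs]] := hP i Pi.
by apply: map_f; rewrite mem_filter /strict hs mem_iota.
Qed.

Lemma separating_form m q (v : 'rV[K]_m) (B : 'M[K]_(q, m)) :
  ~~ (v <= B)%MS -> exists2 f : 'rV[K]_m, f *m B^T = 0 & f *m v^T != 0.
Proof.
rewrite submxE => /rV0Pn[j hj].
exists (row j (cokermx B)^T).
  rewrite -row_mul -trmx_mul mulmx_coker trmx0.
  by apply/rowP => k; rewrite !mxE.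
apply/eqP => /matrixP/(_ 0 0); rewrite -row_mul -trmx_mul !mxE => h0.
by move: hj; rewrite !mxE h0 eqxx.
Qed.

End LinearAlgebra.

(** * Algebras and modules as row spaces *)

Section RowSpaces.
Variables (K : fieldType) (N : nat).
Implicit Types (S R : 'M[K]_(N * N)) (X Y t : 'M[K]_N).

Lemma inA0 S : inA S 0.
Proof. by rewrite /inA linear0 sub0mx. Qed.

Lemma inA_lin S (c : K) X Y : inA S X -> inA S Y -> inA S (c *: X + Y).
Proof. exact: memxvec_linear. Qed.

Lemma inAD S X Y : inA S X -> inA S Y -> inA S (X + Y).
Proof. by move=> hX hY; rewrite -[X]scale1r; exact: inA_lin. Qed.

Lemma inAZ S (c : K) X : inA S X -> inA S (c *: X).
Proof. by move=> hX; rewrite -[_ *: _]addr0; apply: inA_lin => //; exact: inA0. Qed.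

Lemma inAN S X : inA S X -> inA S (- X).
Proof. by rewrite -scaleN1r; exact: inAZ. Qed.

Lemma inAB S X Y : inA S X -> inA S Y -> inA S (X - Y).
Proof. by move=> hX /inAN; exact: inAD. Qed.

Lemma inA_sum S (I : finType) (P : pred I) (F : I -> 'M[K]_N) :
  (forall i, P i -> inA S (F i)) -> inA S (\sum_(i | P i) F i).
Proof. by move=> h; apply: big_ind h => [|X Y]; [exact: inA0 | exact: inAD]. Qed.

Lemma inA_sub S S' : (S <= S')%MS -> forall X, inA S X -> inA S' X.
Proof. by move=> h X /submx_trans; apply. Qed.

Lemma inA_subP q (S : 'M[K]_(q, N * N)) S' :
  (forall X, (mxvec X <= S)%MS -> inA S' X) -> (S <= S')%MS.
Proof. by move=> h; apply/rV_subP => v; have := h (vec_mx v); rewrite /inA vec_mxK. Qed.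

Lemma inA_elim (Pr : 'M[K]_N -> Prop) S :
  Pr 0 -> (forall c X Y, Pr X -> Pr Y -> Pr (c *: X + Y)) ->
  (forall i, Pr (vec_mx (row i S))) -> forall X, inA S X -> Pr X.
Proof.
move=> P0 PD PS X /submxP[D hD].
rewrite -(mxvecK X) hD mulmx_sum_row linear_sum.
elim/big_rec: _ => // i Y _ PY; rewrite linearZ /=.
exact: PD (PS i) PY.
Qed.

Lemma mat_act X Y : mxvec Y *m mact Mat X = mxvec (X *m Y).
Proof. exact: (mul_vec_lin (mulmx X) Y). Qed.

Lemma mulr_act X Y : mxvec Y *m lin_mulmxr X = mxvec (Y *m X).
Proof. exact: (mul_vec_lin (mulmxr X) Y). Qed.

Lemma mulmx_mulmxr_comm X t :
  lin_mulmx X *m lin_mulmxr t = lin_mulmxr t *m lin_mulmx X :> 'M[K]_(N * N).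
Proof.
apply/row_matrixP => s; rewrite !rowE !mulmxA -[delta_mx 0 s]vec_mxK.
by rewrite (mat_act X) !mulr_act (mat_act X) mulmxA.
Qed.

Lemma inA_mulr S t X : inA (S *m lin_mulmxr t) X <-> exists2 Y, inA S Y & X = Y *m t.
Proof.
split=> [/submxP[D hD]|[Y hY ->]]; last by rewrite /inA -mulr_act submxMr.
exists (vec_mx (D *m S)); first by rewrite /inA vec_mxK submxMl.
apply: (can_inj mxvecK).
by rewrite hD mulmxA -{1}(vec_mxK (D *m S)) mulr_act.
Qed.

Lemma inA_mull S t X : inA (S *m lin_mulmx t) X <-> exists2 Y, inA S Y & X = t *m Y.
Proof.
split=> [/submxP[D hD]|[Y hY ->]].
  exists (vec_mx (D *m S)); first by rewrite /inA vec_mxK submxMl.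
  apply: (can_inj mxvecK).
  by rewrite hD mulmxA -{1}(vec_mxK (D *m S)) (mat_act t).
by rewrite /inA -(mat_act t) submxMr.
Qed.

Lemma submod_MatP R S :
  submod R Mat S <-> forall X Y, inA R X -> inA S Y -> inA S (X *m Y).
Proof.
split=> h X => [Y hX hY|hX].
  by rewrite /inA -mat_act; apply: submx_trans (h X hX); exact: submxMr.
by apply: inA_subP => Y /(inA_mull S X Y)[Z hZ ->]; exact: h.
Qed.

(* [phi] is a linear form on ['M_N] and [phi *m (mxvec Y)^T] its value at [Y]. *)
Lemma dmat_act X Y (phi : 'rV[K]_(N * N)) :
  (phi *m mact DMat X) *m (mxvec Y)^T = phi *m (mxvec (Y *m X))^T.
Proof. by rewrite -mulmxA -trmx_mul mulr_act. Qed.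

Lemma mem_mulsp S S' X Y : inA S X -> inA S' Y -> inA (mulsp S S') (X *m Y).
Proof.
move=> hX hY; move: X hX; apply: inA_elim.
- by rewrite mul0mx; exact: inA0.
- by move=> c X Z hX hZ; rewrite mulmxDl -scalemxAl; exact: inA_lin.
move=> i; move: Y hY; apply: inA_elim.
- by rewrite mulmx0; exact: inA0.
- by move=> c X Z hX hZ; rewrite mulmxDr -scalemxAr; exact: inA_lin.
move=> j; rewrite /inA /mulsp.
by rewrite (sumsmx_sup i) // (sumsmx_sup j) // genmxE.
Qed.

End RowSpaces.

(** * Up-sets of vertices, extremal elements, induction from the top *)

Section Posets.
Variables (n : nat) (le : rel 'I_n).
Hypothesis Hpo : partial_order n le.

Definition above (l m : 'I_n) := (l != m) && le l m.
Definition upset (U : pred 'I_n) := forall l m, U l -> le l m -> U m.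

Lemma le_refl l : le l l. Proof. by case: Hpo. Qed.
Lemma le_trans a b c : le a b -> le b c -> le a c.
Proof. by case: Hpo => _ [_ tr] ab bc; exact: tr bc. Qed.
Lemma le_anti a b : le a b -> le b a -> a = b.
Proof. by case: Hpo => _ [an _] ab ba; apply: an; rewrite ab. Qed.

Lemma above_upset l : upset (above l).
Proof.
move=> a b /andP[la ha] hb; rewrite /above (le_trans ha hb) andbT.
apply: contraNneq la => lb; rewrite -lb in hb.
by apply/eqP; exact: le_anti.
Qed.

Lemma not_below_upset i : upset (fun m => ~~ le m i).
Proof. by move=> a b ha hab; apply: contra ha; exact: le_trans. Qed.

Lemma ex_minimal (P : pred 'I_n) i0 : P i0 ->
  exists2 i, P i & forall j, P j -> le j i -> j = i.
Proof.
move=> P0; case: (arg_minnP (fun i => #|[pred j | le j i]|) P0) => i Pi hi.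
exists i => // j Pj ji; apply: le_anti => //.
have : [pred k | le k j] \subset [pred k | le k i].
  by apply/subsetP => k; rewrite !inE => /le_trans; apply.
move/subset_leqif_card => /geq_leqif.
by rewrite (hi j Pj) => /esym/subsetP/(_ i); rewrite !inE le_refl; apply.
Qed.

Lemma ex_maximal (P : pred 'I_n) i0 : P i0 ->
  exists i, [/\ P i, le i0 i & forall j, P j -> le i j -> j = i].
Proof.
move=> P0.
pose Q i := P i && le i0 i.
have P0' : Q i0 by rewrite /Q P0 le_refl.
case: (arg_maxnP (fun i => #|[pred j | le j i]|) P0') => i /andP[Pi h0] hi.
exists i; split=> // j Pj ij; apply: le_anti => //.
have : [pred k | le k i] \subset [pred k | le k j].
  by apply/subsetP => k; rewrite !inE => /le_trans; apply.
move/subset_leqif_card => /geq_leqif.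
rewrite [(_ <= _)%N](hi j) /Q ?Pj ?(le_trans h0 ij) //.
by move=> /esym/subsetP/(_ j); rewrite !inE le_refl; apply.
Qed.

Lemma down_ind (Pr : 'I_n -> Prop) :
  (forall l, (forall m, above l m -> Pr m) -> Pr l) -> forall l, Pr l.
Proof.
move=> H l; move: {2}#|_|.+1 (ltnSn #|[pred m | above l m]|) => k.
elim: k l => // k IH l hk; apply: H => m lm; apply: IH.
rewrite ltnS in hk; apply: leq_trans hk.
apply: proper_card; apply/properP; split.
  by apply/subsetP => x; rewrite !inE => mx; apply: (above_upset lm); case/andP: mx.
by exists m; rewrite !inE // /above eqxx.
Qed.

End Posets.

(** * Corners of a basic algebra and the ideals generated by its idempotents *)

Section Algebra.
Variables (K : fieldType) (N n : nat) (R : 'M[K]_(N * N)).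
Variables (e : 'I_n -> 'M[K]_N).
Hypothesis HA : basic_alg R e.

Lemma R1 : inA R 1%:M. Proof. by case: HA => -[]. Qed.
Lemma RM X Y : inA R X -> inA R Y -> inA R (X *m Y).
Proof. by case: HA => -[_ h] _; exact: h. Qed.
Lemma Re i : inA R (e i). Proof. by case: HA => _ [h _]; case: (h i). Qed.
Lemma eK i : e i *m e i = e i.
Proof. by case: HA => _ [_ [-> _]]; rewrite eqxx. Qed.
Lemma e_orth i j : i != j -> e i *m e j = 0.
Proof. by case: HA => _ [_ [-> _]] /negPf ->. Qed.
Lemma sum_e : \sum_(i < n) e i = 1%:M. Proof. by case: HA => _ [_ [_ []]]. Qed.

Definition corner b a (X : 'M[K]_N) := [/\ inA R X, e b *m X = X & X *m e a = X].

Lemma corner_lin b a c X Y : corner b a X -> corner b a Y -> corner b a (c *: X + Y).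
Proof.
case=> h1 h2 h3 [g1 g2 g3]; split; first exact: inA_lin.
  by rewrite mulmxDr -scalemxAr h2 g2.
by rewrite mulmxDl -scalemxAl h3 g3.
Qed.

Lemma corner0 b a : corner b a 0.
Proof. by split; rewrite ?mulmx0 ?mul0mx //; exact: inA0. Qed.

Lemma corner_e b : corner b b (e b).
Proof. by split; rewrite ?eK //; exact: Re. Qed.

Lemma corner_mul c b a X Y : corner c b X -> corner b a Y -> corner c a (X *m Y).
Proof.
case=> h1 h2 h3 [g1 g2 g3]; split; first exact: RM.
  by rewrite mulmxA h2.
by rewrite -mulmxA g3.
Qed.

Lemma corner_cut b a X : inA R X -> corner b a (e b *m X *m e a).
Proof.
move=> hX; split; first by apply: RM (Re a); apply: RM (Re b) hX.
  by rewrite !mulmxA eK.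
by rewrite -!mulmxA eK.
Qed.

Lemma inPmx a X : inA (Pmx R e a) X <-> inA R X /\ X *m e a = X.
Proof.
apply: iff_trans (inA_mulr _ _ _) _; split=> [[Y hY ->]|[h1 h2]]; last by exists X.
by rewrite -mulmxA eK; split=> //; apply: RM (Re a).
Qed.

Lemma inPrmx a X : inA (Prmx K N R n e a) X <-> inA R X /\ e a *m X = X.
Proof.
apply: iff_trans (inA_mull _ _ _) _; split=> [[Y hY ->]|[h1 h2]]; last by exists X.
by rewrite mulmxA eK; split=> //; apply: RM (Re a) _.
Qed.

Lemma inAmul t X : inA (Amul R t) X <-> exists2 r, inA R r & X = r *m t.
Proof. exact: inA_mulr. Qed.

Lemma Amul_submod t : submod R Mat (Amul R t).
Proof.
apply/submod_MatP => X Y hX /inAmul[r hr ->].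
by apply/inAmul; exists (X *m r); [exact: RM | rewrite mulmxA].
Qed.

Lemma Pmx_submod a : submod R Mat (Pmx R e a). Proof. exact: Amul_submod. Qed.

Lemma zero_submod M : submod R M 0.
Proof. by move=> X _; rewrite mul0mx. Qed.

Lemma Mat_lmod : is_lmod R Mat.
Proof.
split; [|split] => [|X Y _ _|c X Y _ _]; apply/row_matrixP => i.
- by rewrite !rowE mulmx1 -[delta_mx 0 i]vec_mxK mat_act mul1mx.
- by rewrite !rowE mulmxA -[delta_mx 0 i]vec_mxK !mat_act mulmxA.
rewrite !rowE mulmxDr -scalemxAr -[delta_mx 0 i]vec_mxK !mat_act.
by rewrite mulmxDl -scalemxAl linearP.
Qed.

Lemma DMat_lmod : is_lmod R DMat.
Proof.
split; [|split] => [|X Y _ _|c X Y _ _] /=.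
- apply: trmx_inj; rewrite trmxK trmx1; apply/row_matrixP => i.
  by rewrite !rowE mulmx1 -[delta_mx 0 i]vec_mxK mulr_act mulmx1.
- rewrite -trmx_mul; congr trmx; apply/row_matrixP => i.
  by rewrite !rowE mulmxA -[delta_mx 0 i]vec_mxK !mulr_act mulmxA.
rewrite -linearP; congr trmx; apply/row_matrixP => i.
rewrite !rowE mulmxDr -scalemxAr -[delta_mx 0 i]vec_mxK !mulr_act.
by rewrite mulmxDr -scalemxAr linearP.
Qed.

(** This is A f A for f the sum of the [e m] with m in [U]. Written as a sum over vertices, it
    reduces every argument to products running through one vertex. *)
Definition ideal (U : pred 'I_n) : 'M[K]_(N * N) :=
  (\sum_(m | U m) (Pmx R e m * Prmx K N R n e m))%MS.

Lemma ideal_mem (U : pred 'I_n) m u v : U m -> inA R u -> inA R v ->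
  inA (ideal U) (u *m e m *m v).
Proof.
move=> Um hu hv; rewrite /inA /ideal (sumsmx_sup m) // -{1}(eK m) !mulmxA -mulmxA.
apply: mem_mulsmx; [apply/inPmx | apply/inPrmx].
  by rewrite -mulmxA eK; split=> //; apply: RM (Re m).
by rewrite mulmxA eK; split=> //; apply: RM hv; exact: Re.
Qed.

Lemma ideal_elim (U : pred 'I_n) (Pr : 'M[K]_N -> Prop) :
  Pr 0 -> (forall c X Y, Pr X -> Pr Y -> Pr (c *: X + Y)) ->
  (forall m u v, U m -> inA R u -> u *m e m = u -> inA R v -> e m *m v = v ->
     Pr (u *m v)) ->
  forall X, inA (ideal U) X -> Pr X.
Proof.
move=> P0 PD PM X; rewrite /inA /ideal => /memmx_sumsP[F -> hF].
have PA Y Z : Pr Y -> Pr Z -> Pr (Y + Z) by rewrite -{2}[Y]scale1r; exact: PD.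
apply: (big_ind Pr) => // m Um.
have /mulsmxP[A1 h1 [A2 h2 ->]] := hF m.
apply: (big_ind Pr) => // s _.
have [? ?] := (inPmx _ _).1 (h1 s); have [? ?] := (inPrmx _ _).1 (h2 s).
exact: (PM m).
Qed.

Lemma ideal_mull U X Y : inA R X -> inA (ideal U) Y -> inA (ideal U) (X *m Y).
Proof.
move=> hX; move: Y; apply: ideal_elim.
- by rewrite mulmx0; exact: inA0.
- by move=> c Y Z hY hZ; rewrite mulmxDr -scalemxAr; exact: inA_lin.
move=> m u v Um hu <- hv _; rewrite !mulmxA.
by apply: ideal_mem => //; exact: RM.
Qed.

Lemma ideal_mulr U X Y : inA R X -> inA (ideal U) Y -> inA (ideal U) (Y *m X).
Proof.
move=> hX; move: Y; apply: ideal_elim.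
- by rewrite mul0mx; exact: inA0.
- by move=> c Y Z hY hZ; rewrite mulmxDl -scalemxAl; exact: inA_lin.
move=> m u v Um hu <- hv _; rewrite -!mulmxA mulmxA.
by apply: ideal_mem => //; exact: RM.
Qed.

Lemma ideal_R U X : inA (ideal U) X -> inA R X.
Proof.
apply: ideal_elim => [|c Y Z hY hZ|m u v _ hu _ hv _]; first exact: inA0.
  exact: inA_lin.
exact: RM.
Qed.

Lemma ideal_mono (U V : pred 'I_n) : (forall m, U m -> V m) ->
  forall X, inA (ideal U) X -> inA (ideal V) X.
Proof.
move=> UV; apply: ideal_elim => [|c Y Z hY hZ|m u v Um hu <- hv _]; first exact: inA0.
  exact: inA_lin.
by apply: ideal_mem => //; exact: UV.
Qed.

Lemma ideal_e (U : pred 'I_n) m X : U m -> inA R X -> e m *m X = X -> inA (ideal U) X.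
Proof. by move=> Um hX hm; rewrite -hm -(mul1mx (e m)); apply: ideal_mem hX => //; exact: R1. Qed.

Lemma ideal_er (U : pred 'I_n) m X : U m -> inA R X -> X *m e m = X -> inA (ideal U) X.
Proof. by move=> Um hX hm; rewrite -hm -(mulmx1 (_ *m _)); apply: ideal_mem => //; exact: R1. Qed.

Lemma ideal_kill (U : pred 'I_n) (x : 'M[K]_N) :
  (forall m r, U m -> inA R r -> e m *m r *m x = 0) ->
  forall X, inA (ideal U) X -> X *m x = 0.
Proof.
move=> h; apply: ideal_elim => [|c Y Z hY hZ|m u v Um hu _ hv ev].
- by rewrite mul0mx.
- by rewrite mulmxDl -scalemxAl hY hZ scaler0 addr0.
by rewrite -mulmxA -ev h // mulmx0.
Qed.

Lemma ideal_pred0 (U : pred 'I_n) X : (forall m, ~~ U m) -> inA (ideal U) X -> X = 0.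
Proof.
move=> h; move: X; apply: ideal_elim => // [c Y Z -> ->|m u v Um]; first by rewrite scaler0 addr0.
by have := h m; rewrite Um.
Qed.

End Algebra.

(** * Submodules and isomorphisms of subquotients *)

Section Modules.
Variables (K : fieldType) (N : nat) (R : 'M[K]_(N * N)).

Lemma submod_act (M : amod K N) (U : 'M[K]_(mdim M)) q (z : 'M_(q, mdim M)) X :
  submod R M U -> (z <= U)%MS -> inA R X -> (z *m mact M X <= U)%MS.
Proof. by move=> HU hz hX; exact: submx_trans (submxMr _ hz) (HU X hX). Qed.

Lemma rank1_subR m q r (U : 'M[K]_(q, m)) (W : 'M[K]_(r, m)) :
  (W <= U)%MS -> (\rank U - \rank W = 0)%N -> (U <= W)%MS.
Proof.
by move=> WU /eqP; rewrite subn_eq0; have /mxrank_leqif_sup/geq_leqif -> := WU.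
Qed.

Lemma submxB_eq m q r (a b : 'M[K]_(q, m)) (W : 'M_(r, m)) :
  (a - b <= W)%MS -> (a <= W)%MS = (b <= W)%MS.
Proof.
move=> h; apply/idP/idP => h'; first by rewrite -[b](subKr a) addmx_sub // eqmx_opp.
by rewrite -[a](subrK b) addmx_sub.
Qed.

Section Lmod.
Variable M : amod K N.
Hypothesis HM : is_lmod R M.

Lemma act_mul q (z : 'M[K]_(q, mdim M)) X Y : inA R X -> inA R Y ->
  z *m mact M (X *m Y) = z *m mact M Y *m mact M X.
Proof. by move=> hX hY; case: HM => _ [-> // _]; rewrite mulmxA. Qed.

End Lmod.

Section Iso.
Variables (M1 M2 : amod K N).
Variables (U1 W1 : 'M[K]_(mdim M1)) (U2 W2 : 'M[K]_(mdim M2)).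

Lemma isoE : iso R M1 U1 W1 M2 U2 W2 ->
  exists f : 'M[K]_(mdim M1, mdim M2),
  [/\ forall q (z : 'M_(q, _)), (z <= U1)%MS -> (z *m f <= U2)%MS,
      (W2 <= U2)%MS,
      forall y : 'rV_(mdim M2), (y <= U2)%MS ->
        exists2 z : 'rV_(mdim M1), (z <= U1)%MS & (z *m f - y <= W2)%MS,
      forall q (z : 'M_(q, _)), (z <= U1)%MS -> (z *m f <= W2)%MS = (z <= W1)%MS &
      forall X q (z : 'M_(q, _)), inA R X -> (z <= U1)%MS ->
        (z *m mact M1 X *m f - z *m f *m mact M2 X <= W2)%MS].
Proof.
case=> f [/eqmxP fU /eqmxP fW fX]; exists f; split.
- move=> q z hz; rewrite -fU; apply: submx_trans (addsmxSl _ _).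
  exact: submxMr.
- by rewrite -fU addsmxSr.
- move=> y; rewrite -fU => /sub_addsmxP[[a b] ->].
  exists (a *m U1); first exact: submxMl.
  by rewrite mulmxA /= opprD addrA subrr sub0r eqmx_opp submxMl.
- move=> q z hz; rewrite -fW sub_capmx hz /= submxE.
  by rewrite -mulmxA; exact/eqP/sub_kermxP.
move=> X q z hX hz; rewrite -!mulmxA -mulmxBr.
exact: submx_trans (submxMr _ hz) (fX X hX).
Qed.

End Iso.

Lemma iso_eqmx (M1 M2 : amod K N) (U1 W1 U1' W1' : 'M[K]_(mdim M1)) (U2 W2 : 'M[K]_(mdim M2)) :
  (U1 == U1')%MS -> (W1 == W1')%MS -> iso R M1 U1 W1 M2 U2 W2 -> iso R M1 U1' W1' M2 U2 W2.
Proof.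
move=> /eqmxP eU /eqmxP eW [f [h1 h2 h3]]; exists f; split.
- apply/eqmxP; apply: eqmx_trans (eqmxP h1); apply: adds_eqmx => //.
  exact/eqmxMr/eqmx_sym.
- apply/eqmxP; apply: eqmx_trans eW; apply: eqmx_trans (eqmxP h2).
  by apply: cap_eqmx => //; exact: eqmx_sym.
move=> X hX; apply: submx_trans (h3 X hX); apply: submxMr.
by rewrite eU.
Qed.

Section IsoParam.
Variables (M1 M2 : amod K N).
Variables (U1 W1 : 'M[K]_(mdim M1)) (U2 W2 : 'M[K]_(mdim M2)).

(* [Q] parametrises both subquotients; the isomorphism maps [q *m G1] to [q *m G2]. *)
Lemma iso_param p m (Q : 'M[K]_(p, m)) G1 G2 (D : 'M[K]_N -> 'M[K]_m) :
  (Q *m G1 + W1 == U1)%MS -> (Q *m G2 + W2 == U2)%MS ->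
  (forall q : 'rV_m, (q <= Q)%MS -> (q *m G1 <= W1)%MS = (q *m G2 <= W2)%MS) ->
  (forall X, inA R X -> (Q *m D X <= Q)%MS) ->
  (forall X, inA R X -> Q *m D X *m G1 = Q *m G1 *m mact M1 X) ->
  (forall X, inA R X -> Q *m D X *m G2 = Q *m G2 *m mact M2 X) ->
  submod R M1 W1 -> submod R M2 W2 ->
  iso R M1 U1 W1 M2 U2 W2.
Proof.
move=> /eqmxP e1 /eqmxP e2 hker hD h1 h2 s1 s2.
(* The pseudo-inverse of the stacked generators splits a row of [U1] into a part from [Q] and a part
   in [W1]; [f] maps the first by [G2] and the second to 0. The splitting is not unique, but by
   [hker] two choices agree modulo [W2]. *)
pose B := col_mx (Q *m G1) W1.
have eB : (B :=: U1)%MS by apply: eqmx_trans e1; exact: eqmx_sym (addsmxE _ _).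
pose f := pinvmx B *m col_mx (Q *m G2) 0.
have dec (z : 'rV_(mdim M1)) : (z <= U1)%MS ->
    exists a : 'rV_p, (z - a *m Q *m G1 <= W1)%MS /\ z *m f = a *m Q *m G2.
  rewrite -eB => hz; exists (lsubmx (z *m pinvmx B)); split.
    have hz' := mulmxKpV hz; rewrite -[z *m pinvmx B]hsubmxK mul_row_col in hz'.
    suff -> : z - lsubmx (z *m pinvmx B) *m Q *m G1 = rsubmx (z *m pinvmx B) *m W1.
      exact: submxMl.
    by apply/eqP; rewrite subr_eq addrC -mulmxA hz'.
  by rewrite mulmxA -{1}[z *m pinvmx B]hsubmxK mul_row_col mulmx0 addr0 mulmxA.
clearbody f; have QW (a : 'rV_p) : (a *m Q *m G1 <= W1)%MS = (a *m Q *m G2 <= W2)%MS.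
  by apply: hker; rewrite submxMl.
exists f; split.
- apply/eqmxP; apply: eqmx_trans e2; apply/eqmxP/andP; split.
    rewrite addsmx_sub addsmxSr andbT; apply/row_subP => i.
    have [a [_ ]] := dec (row i U1) (row_sub _ _).
    rewrite row_mul => ->; apply: submx_trans (addsmxSl _ _).
    by rewrite -mulmxA submxMl.
  rewrite addsmx_sub addsmxSr andbT; apply/row_subP => i.
  have hz : (row i (Q *m G1) <= U1)%MS.
    by rewrite -e1 (submx_trans (row_sub _ _)) // addsmxSl.
  have [a [ha hf]] := dec _ hz.
  have : ((delta_mx 0 i - a) *m Q *m G1 <= W1)%MS.
    by move: ha; rewrite rowE !mulmxBl !mulmxA.
  rewrite QW !mulmxBl -hf -!mulmxA -!rowE => hd.
  rewrite -[row i _](subrK (row i (Q *m G1) *m f)).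
  by rewrite addrC addmx_sub_adds // submxMr.
- apply/andP; split; apply/rV_subP => z.
    rewrite sub_capmx => /andP[hz /sub_kermxP]; rewrite mulmxA => /eqP.
    rewrite -submxE; have [a [ha ->]] := dec z hz.
    by rewrite -QW => hq; rewrite -[z](subrK (a *m Q *m G1)) addmx_sub.
  move=> hz; have hU : (z <= U1)%MS by rewrite -e1 (submx_trans hz) ?addsmxSr.
  rewrite sub_capmx hU; apply/sub_kermxP/eqP; rewrite mulmxA -submxE.
  have [a [ha ->]] := dec z hU.
  by rewrite -QW -[_ *m G1](subKr z) addmx_sub // eqmx_opp.
move=> X hX; apply/row_subP => i.
rewrite row_mul mulmxBr !mulmxA; set z := row i U1.
have hU1 : submod R M1 U1.
  move=> Y hY; rewrite -(eqmxMr _ e1) addsmxMr -e1; apply: addsmxS; last exact: s1.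
  by rewrite -h1 // submxMr // hD.
have hz : (z <= U1)%MS by exact: row_sub.
have [a [ha hf]] := dec z hz.
have [b [hb hg]] := dec (z *m mact M1 X) (submod_act hU1 hz hX).
rewrite hg hf.
have -> : a *m Q *m G2 *m mact M2 X = a *m Q *m D X *m G2.
  by rewrite -!(mulmxA a) -h2 // !mulmxA.
have [c hc] : exists c, Q *m D X = c *m Q by apply/submxP; exact: hD.
have -> : a *m Q *m D X *m G2 = (a *m c) *m Q *m G2 by rewrite -(mulmxA a) hc !mulmxA.
rewrite -mulmxBl -mulmxBl -QW !mulmxBl.
have -> : a *m c *m Q *m G1 = a *m Q *m G1 *m mact M1 X.
  by rewrite -!(mulmxA a) -h1 // hc !mulmxA.
have := submod_act s1 ha hX; rewrite mulmxBl => hz'.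
by rewrite -(subrKA (z *m mact M1 X)) addmx_sub // -opprB eqmx_opp.
Qed.

End IsoParam.

End Modules.

(** * Standard and costandard subquotients *)

Section StandardModules.
Variables (K : fieldType) (N n : nat) (R : 'M[K]_(N * N)).
Variables (e : 'I_n -> 'M[K]_N) (le : rel 'I_n).
Hypothesis HA : basic_alg R e.

(** Multiplicity 0 is an equality of ranks between nested spaces, so [D] contains all of e_k
    P(l). *)
Lemma DeltaKer_weight D l k X : DeltaKer K N R n e le l D -> ~~ le k l ->
  inA R X -> e k *m X = X -> X *m e l = X -> inA D X.
Proof.
case=> sD DP hD _ hk hX hkX hXl.
have sub := rank1_subR (submxMr (mact Mat (e k)) DP) (hD k hk).
have hXP : inA (Pmx R e l) X by apply/(inPmx HA).
have : (mxvec X *m mact Mat (e k) <= Pmx R e l *m mact Mat (e k))%MS by exact: submxMr.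
move=> /submx_trans/(_ sub); rewrite mat_act hkX => /submx_trans; apply.
exact: sD (Re HA k).
Qed.

(** The vector [x] is a preimage of the generator e_l of Delta(l); it presents the subquotient as A
    e_l modulo [D]. *)
Lemma iso_DeltaE M (U W : 'M[K]_(mdim M)) l :
  is_lmod R M -> submod R M U -> submod R M W -> iso_Delta R e le M U W l ->
  exists D (x : 'rV_(mdim M)),
   [/\ DeltaKer K N R n e le l D, (x <= U)%MS, x *m mact M (e l) = x,
       forall z : 'rV_(mdim M), (z <= U)%MS ->
         exists2 r, inA R r & (z - x *m mact M r <= W)%MS &
       forall r, inA R r -> (x *m mact M r <= W)%MS = (mxvec (r *m e l) <= D)%MS].
Proof.
move=> HM sU sW [D [hD /isoE[f [fU DU fsurj fker fact]]]].
have sD : submod R Mat D by case: hD.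
have el : inA (Pmx R e l) (e l) by apply/(inPmx HA); rewrite (eK HA); split=> //; exact: Re.
have [x0 x0U hx0] := fsurj _ el.
(* The cut by [e l] gives [x] weight l exactly, not only modulo [W]. *)
pose x := x0 *m mact M (e l).
have xU : (x <= U)%MS by exact: submod_act (Re HA l).
have fx : (x *m f - mxvec (e l) <= D)%MS.
  have h1 := fact (e l) _ x0 (Re HA l) x0U.
  have h2 := submod_act sD hx0 (Re HA l).
  move: h2; rewrite mulmxBl mat_act (eK HA) => h2.
  by rewrite -(subrKA (x0 *m f *m mact Mat (e l))) addmx_sub.
have fxr r : inA R r -> (x *m mact M r *m f - mxvec (r *m e l) <= D)%MS.
  move=> hr; have h1 := fact r _ x hr xU.
  have h2 := submod_act sD fx hr.
  move: h2; rewrite mulmxBl mat_act => h2.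
  by rewrite -(subrKA (x *m f *m mact Mat r)) addmx_sub.
exists D, x; split=> // [|z zU|r hr].
- by rewrite /x -(act_mul HM) ?(eK HA) //; exact: Re.
- have [p hp] : exists p, z *m f = mxvec p by exists (vec_mx (z *m f)); rewrite vec_mxK.
  have := fU _ z zU; rewrite hp => /(inPmx HA)[pR pe].
  exists p => //; rewrite -fker; last first.
    by rewrite addmx_sub // eqmx_opp; exact: submod_act sU xU pR.
  rewrite mulmxBl hp -{1}pe -opprB eqmx_opp; exact: fxr.
rewrite -fker; last exact: submod_act sU xU hr.
exact: submxB_eq (fxr r hr).
Qed.

Lemma Iker_mem l (phi : 'rV[K]_(N * N)) : (phi <= Iker K N R n e l)%MS <->
  forall Y, inA R Y -> e l *m Y = Y -> phi *m (mxvec Y)^T = 0.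
Proof.
split=> [/sub_kermxP h Y hY eY|h].
  have /submxP[d ->] : inA (Prmx K N R n e l) Y by apply/(inPrmx HA).
  by rewrite trmx_mul mulmxA h mul0mx.
apply/sub_kermxP; apply: trmx_inj; rewrite trmx_mul trmxK trmx0.
apply/row_matrixP => i; rewrite row_mul row0.
have /(inPrmx HA)[hY eY] : inA (Prmx K N R n e l) (vec_mx (row i (Prmx K N R n e l))).
  by rewrite /inA vec_mxK row_sub.
by move/(congr1 trmx): (h _ hY eY); rewrite trmx_mul trmxK trmx0 vec_mxK.
Qed.

(** Three consequences of nabla(l) lying in I(l) = D(e_l A): its socle is S(l), so every nonzero
    vector is moved to a nonzero one of weight l; its weights are below l; and it contains every
    form vanishing on e_l I_U, U = {not <= l}, so that an element of e_l A e_a outside I_U witnesses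
    the weight a. *)
Lemma iso_NablaE M (U W : 'M[K]_(mdim M)) l :
  submod R M U -> iso_Nabla R e le M U W l ->
  [/\ forall z : 'rV_(mdim M), (z <= U)%MS -> ~~ (z <= W)%MS ->
        exists2 r, inA R r & ~~ (z *m mact M r *m mact M (e l) <= W)%MS,
      forall k, ~~ le k l -> (U *m mact M (e k) <= W)%MS &
      forall a C, inA R C -> e l *m C = C -> C *m e a = C ->
        ~ inA (ideal R e (fun m => ~~ le m l)) C ->
        exists2 z : 'rV_(mdim M), (z <= U)%MS & ~~ (z *m mact M (e a) <= W)%MS].
Proof.
move=> sU [V [[sV IV hV maxV] /isoE[f [fU _ fsurj fker fact]]]].
set I := Iker K N R n e l in IV hV maxV fsurj fker fact *.
have inI := Iker_mem l : forall phi, (phi <= I)%MS <-> _.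
have sI : submod R DMat I.
  move=> X hX; apply/row_subP => i; rewrite row_mul; apply/inI => Y hY eY.
  rewrite dmat_act; apply: (inI _).1; first exact: row_sub.
    exact: (RM HA).
  by rewrite mulmxA eY.
split.
- move=> z zU zW.
  have : ~~ (z *m f <= I)%MS by rewrite fker.
  case/row_subPn => i0; rewrite row_id => hz.
  have [Y [hY eY hzY]] : exists Y, [/\ inA R Y, e l *m Y = Y & z *m f *m (mxvec Y)^T != 0].
    move: hz; rewrite sub_kermx => hz.
    have : (Prmx K N R n e l) *m (z *m f)^T != 0.
      by apply: contra hz => /eqP h; rewrite -[_ *m _^T]trmxK trmx_mul trmxK h trmx0.
    case/matrix0Pn => i [j hij].
    exists (vec_mx (row i (Prmx K N R n e l))).
    have /(inPrmx HA)[hY eY] : inA (Prmx K N R n e l) (vec_mx (row i (Prmx K N R n e l))).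
      by rewrite /inA vec_mxK row_sub.
    split=> //; rewrite vec_mxK; apply/eqP => /(congr1 trmx).
    rewrite trmx_mul trmxK trmx0 -row_mul => /matrixP/(_ 0 j).
    by rewrite mxE => h; move: hij; rewrite h mxE eqxx.
  exists Y => //; apply/negP.
  have zY : (z *m mact M Y <= U)%MS by exact: submod_act sU zU hY.
  have zYl : (z *m mact M Y *m mact M (e l) <= U)%MS by exact: submod_act sU zY (Re HA l).
  rewrite -fker // => h.
  have h1 := fact (e l) _ _ (Re HA l) zY.
  have h2 := submod_act sI (fact Y _ _ hY zU) (Re HA l).
  have h3 : (z *m f *m mact DMat Y *m mact DMat (e l) <= I)%MS.
    rewrite mulmxBl in h2.
    by rewrite -(submxB_eq h2) -(submxB_eq h1).
  move/inI: h3 => /(_ (e l) (Re HA l) (eK HA l)).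
  by rewrite !dmat_act (eK HA) eY => h0; rewrite h0 eqxx in hzY.
- move=> k hk.
  have sub := rank1_subR (submxMr (mact DMat (e k)) IV) (hV k hk).
  apply/row_subP => i; rewrite row_mul; set z := row i U.
  have zU : (z <= U)%MS by exact: row_sub.
  rewrite -fker; last exact: submod_act (Re HA k).
  have h1 := fact (e k) _ _ (Re HA k) zU.
  rewrite (submxB_eq h1).
  apply: submx_trans (submxMr _ (fU _ _ zU)) _.
  by apply: submx_trans sub _; exact: sI (Re HA k).
move=> a C hC eC Ca Cn.
set J := ideal R e _ in Cn.
pose B := J *m lin_mulmx (e l).
have inB Y : inA B Y <-> inA J Y /\ e l *m Y = Y.
  apply: iff_trans (inA_mull _ _ _) _; split=> [[X hX ->]|[h1 h2]]; last by exists Y.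
  by rewrite mulmxA (eK HA); split=> //; apply: (ideal_mull HA) => //; exact: Re.
have : ~~ (mxvec C <= B)%MS by apply/negP => /inB[].
case/separating_form => phi phiB phiC.
(* The forms vanishing on e_l [J] are a submodule because [J] is stable under right multiplication,
   and modulo [I] their weights are below l because [J] contains the other idempotents. Maximality
   of [V] then puts [phi] into [V]. *)
pose V' := kermx B^T.
have inV (psi : 'rV_(N * N)) :
    (psi <= V')%MS <-> forall Y, inA J Y -> e l *m Y = Y -> psi *m (mxvec Y)^T = 0.
  split=> [/sub_kermxP h Y hY eY|h].
    have /submxP[d ->] : inA B Y by apply/inB.
    by rewrite trmx_mul mulmxA h mul0mx.
  apply/sub_kermxP; apply: trmx_inj; rewrite trmx_mul trmxK trmx0.
  apply/row_matrixP => i; rewrite row_mul row0.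
  have /inB[hY eY] : inA B (vec_mx (row i B)) by rewrite /inA vec_mxK row_sub.
  by move/(congr1 trmx): (h _ hY eY); rewrite trmx_mul trmxK trmx0 vec_mxK.
have sV' : submod R DMat V'.
  move=> X hX; apply/row_subP => i; rewrite row_mul; apply/inV => Y hY eY.
  rewrite dmat_act; apply: (inV _).1; first exact: row_sub.
    exact: (ideal_mulr HA hX hY).
  by rewrite mulmxA eY.
have IV' : (I <= V')%MS.
  apply/row_subP => i; apply/inV => Y hY eY.
  by apply: (inI _).1 => //; [exact: row_sub | exact: (ideal_R HA hY)].
have wV' k : ~~ le k l -> mult K N n e DMat V' I k = 0%N.
  move=> hk; apply/eqP; rewrite subn_eq0; apply: mxrankS.
  have VI : (V' *m mact DMat (e k) <= I)%MS.
    apply/row_subP => i; rewrite row_mul; apply/inI => Y hY eY.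
    rewrite dmat_act; apply: (inV _).1; first exact: row_sub.
      apply: (ideal_er HA (m := k)) => //; first exact: (RM HA) (Re HA k).
      by rewrite -mulmxA (eK HA).
    by rewrite mulmxA eY.
  have := submxMr (mact DMat (e k)) VI; rewrite -(act_mul (DMat_lmod R)) ?(eK HA) //;
    exact: Re.
have V'V := maxV V' sV' IV' wV'.
have phiV : (phi <= V)%MS by apply: submx_trans V'V; apply/sub_kermxP.
have [z zU hz] := fsurj phi phiV.
exists z => //; rewrite -fker; last exact: submod_act (Re HA a).
apply/negP => h.
have h1 := fact (e a) _ _ (Re HA a) zU.
have h2 := submod_act sI hz (Re HA a); rewrite mulmxBl in h2.
have : (phi *m mact DMat (e a) <= I)%MS.
  by rewrite -(submxB_eq h2) -(submxB_eq h1).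
move/inI/(_ C hC eC); rewrite dmat_act Ca => h0.
by rewrite h0 eqxx in phiC.
Qed.

End StandardModules.

Lemma chain_mono (K : fieldType) m (c : nat -> 'M[K]_m) t :
  (forall s, (s < t)%N -> (c s <= c s.+1)%MS) ->
  forall s s', (s <= s')%N -> (s' <= t)%N -> (c s <= c s')%MS.
Proof.
move=> cS s; elim=> [|s' IH]; first by rewrite leqn0 => /eqP ->.
rewrite leq_eqVlt => /orP[/eqP -> //|]; rewrite ltnS => ss' s't.
exact: submx_trans (IH ss' (ltnW s't)) (cS _ s't).
Qed.

(** * Bases of the corners of a 1-quasi-hereditary algebra *)

Section OneQuasiHereditary.
Variables (K : fieldType) (N n : nat) (R : 'M[K]_(N * N)).
Variables (e : 'I_n -> 'M[K]_N) (le : rel 'I_n) (bot top : 'I_n).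
Hypothesis Hq : one_qh R e le bot top.

Let HA : basic_alg R e. Proof. by case: Hq => -[]. Qed.
Let Hpo : partial_order n le. Proof. by case: Hq => -[_ []]. Qed.
Local Notation DeltaKer := (DeltaKer K N R n e le).
Local Notation ideal := (ideal R e).
Local Notation corner := (corner R e).

Lemma le_bot i : le bot i. Proof. by case: Hq => _ /(_ i)[]. Qed.
Lemma le_top i : le i top. Proof. by case: Hq => _ /(_ i)[]. Qed.

Lemma above_top m : ~~ above le top m.
Proof.
apply/negP => /andP[/eqP h1 h2]; apply: h1.
exact: (le_anti Hpo h2 (le_top m)).
Qed.

Lemma above_not_le l m : above le l m -> ~~ le m l.
Proof.
by case/andP => /eqP h1 h2; apply/negP => h3; apply: h1; exact: (le_anti Hpo).
Qed.

Lemma Pmx_filtration a : exists t c lab,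
  [/\ filt K N R n (iso_Delta R e le) Mat (Pmx R e a) 0 t c lab &
      forall l, count (fun s => lab s == l) (iota 0 t) = le a l].
Proof.
have [_ _ h3 _ _] := Hq.
have [_ /(_ a)[_ [t [c [lab hf]]] h0 _]] : quasi_hered K N R n e le by case: Hq => -[].
exists t, c, lab; split=> // l; case: (boolP (le a l)) => al.
  by have [_ hh] := h3 l a al; exact: (hh t c lab hf).
exact: h0 al t c lab hf.
Qed.

Lemma DeltaKer_mult l D k : DeltaKer l D -> mult K N n e Mat (Pmx R e l) D k = le k l.
Proof.
move=> hD; case: (boolP (le k l)) => kl; last by case: hD => _ _ ->.
have [_ _ /(_ l k kl)[[D' [hD' hm]] _] _ _] := Hq; rewrite -[RHS]hm.
have [s1 p1 w1 m1] := hD; have [s2 p2 w2 m2] := hD'.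
rewrite /mult; congr (_ - _)%N; apply: eqmx_rank; apply/eqmxP/eqmxMr/eqmxP.
by apply/andP; split; [exact: m1 | exact: m2].
Qed.

Lemma DeltaKer_corner l D b : DeltaKer l D -> le b l ->
  exists2 Y, corner b l Y & ~ inA D Y /\
    forall r, corner b l r -> exists c, inA D (r - c *: Y).
Proof.
move=> hD bl; have hm := DeltaKer_mult b hD; rewrite bl in hm.
have [sD DP _ _] := hD.
have sub : (D *m mact Mat (e b) <= Pmx R e l *m mact Mat (e b))%MS by exact: submxMr.
have DbD : (D *m mact Mat (e b) <= D)%MS by exact: sD (Re HA b).
have inC r : corner b l r <-> inA (Pmx R e l *m mact Mat (e b)) r.
  split=> [[hr br rl]|/inA_mull[Y /(inPmx HA)[hY Yl] ->]].
    by apply/inA_mull; exists r => //; apply/(inPmx HA).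
  split; first by apply: (RM HA) => //; exact: Re.
    by rewrite mulmxA (eK HA).
  by rewrite -mulmxA Yl.
have hr1 : (\rank (Pmx R e l *m mact Mat (e b)) - \rank (D *m mact Mat (e b)) <= 1)%N.
  by move: hm; rewrite /mult => ->.
have [y yU hy] := corank1_complement sub hr1.
have yE : corner b l (vec_mx y) by apply/inC; rewrite /inA vec_mxK.
have span r : corner b l r -> exists c, inA D (r - c *: vec_mx y).
  move=> /inC/hy[c hc]; exists c; rewrite /inA linearB linearZ /= vec_mxK.
  exact: submx_trans hc DbD.
exists (vec_mx y) => //; split=> // yD.
have : (Pmx R e l *m mact Mat (e b) <= D *m mact Mat (e b))%MS.
  apply: inA_subP => r hr; have hE := (inC r).2 hr.
  have [c hc] := span r hE; have [_ br _] := hE.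
  have : inA D r by rewrite -(subrK (c *: vec_mx y) r); apply: inAD => //; exact: inAZ.
  by move=> rD; apply/inA_mull; exists r.
by move/mxrankS; rewrite -subn_eq0; move: hm; rewrite /mult => ->.
Qed.

(** Read along the Delta-filtration of P(a): a factor Delta(m) without weight b adds nothing to e_b
    A e_a, one with m > l adds elements of A e_m A, and Delta(l) occurs at most once and has weight
    b at most once. The condition on l leaves no other case. *)
Lemma corner_span_above b a l :
  (forall m, le a m -> le b m -> le l m) ->
  exists2 x, corner b a x &
    (forall r, corner b a r -> exists c, inA (ideal (above le l)) (r - c *: x)) /\
    (~~ (le a l && le b l) -> x = 0).
Proof.
move=> hl; have [t [c [lab [[c0 ct cs cS] hc]]]] := Pmx_filtration a.
have cP s : (s <= t)%N -> (c s <= Pmx R e a)%MS.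
  by move=> st; rewrite -(eqmxP ct); apply: (chain_mono (t := t)) => // i /cS[].
(* The last clause lets the single factor Delta(l) install its generator: until that factor is met
   [x] is 0, so two generators never have to be merged. *)
suff : forall s, (s <= t)%N -> exists2 x, corner b a x &
    (forall r, corner b a r -> inA (c s) r -> exists d, inA (ideal (above le l)) (r - d *: x)) /\
    ((count (fun s => lab s == l) (iota 0 s) == 0%N) || ~~ le b l -> x = 0).
  move=> /(_ t (leqnn t))[x xE [h1 h2]]; exists x => //; split.
    move=> r hr; apply: h1 => //; rewrite /inA (eqmxP ct); apply/(inPmx HA).
    by case: hr.
  by rewrite negb_and => h; apply: h2; rewrite hc; case: (le a l) h.
elim=> [_|s IH st].
  exists 0; first exact: corner0; split=> // r _; rewrite /inA (eqmxP c0) submx0 => /eqP h.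
  exists 0; rewrite scaler0 subr0.
  by rewrite /inA h sub0mx.
have [x xE [h1 h2]] := IH (ltnW st).
have [css hD] := cS s st; set m := lab s in hD.
have [D [v [DK vU ve vgen vker]]] := iso_DeltaE HA (Mat_lmod R) (cs s.+1) (cs s) hD.
pose X := vec_mx v.
have vX : v = mxvec X by rewrite vec_mxK.
have hX : inA (c s.+1) X by rewrite /inA -vX.
have eX : e m *m X = X by apply: (can_inj mxvecK); rewrite -mat_act -vX.
have [XR Xa] : inA R X /\ X *m e a = X by apply/(inPmx HA); exact: inA_sub (cP _ st) _ hX.
have gen r : corner b a r -> inA (c s.+1) r -> exists2 p, corner b m p & inA (c s) (r - p *m X).
  move=> [hr br ra] hrc; have [p hp h] := vgen (mxvec r) hrc.
  exists (e b *m p *m e m); first exact: corner_cut.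
  rewrite -[_ *m X]mulmxA eX -mulmxA -{1}br -mulmxBr.
  apply: ((submod_MatP _ _).1 (cs s)); first exact: Re.
  by rewrite /inA linearB /= -mat_act -vX.
have ker p : corner b m p -> inA (c s) (p *m X) <-> inA D p.
  by move=> [hp _ pm]; rewrite /inA -mat_act -vX vker // pm.
have pXE p : corner b m p -> corner b a (p *m X).
  move=> [hp bp pm]; split; first exact: (RM HA).
    by rewrite mulmxA bp.
  by rewrite -mulmxA Xa.
have cnt : count (fun s => lab s == l) (iota 0 s.+1) =
    (count (fun s => lab s == l) (iota 0 s) + (m == l))%N.
  by rewrite -addn1 iotaD count_cat /= add0n addn0.
have cntt : (count (fun s => lab s == l) (iota 0 s.+1) <= 1)%N.
  apply: (@leq_trans (count (fun s => lab s == l) (iota 0 t))); last first.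
    by rewrite hc; case: (le a l).
  by rewrite -(subnKC st) iotaD count_cat leq_addr.
have [bm|bm] := boolP (le b m); last first.
  exists x => //; split.
    move=> r hr hrc; apply: h1 => //; have [p hp h] := gen r hr hrc.
    rewrite -(subrK (p *m X) r); apply: inAD h _; apply/(ker p hp).
    by have [? ? ?] := hp; exact: (DeltaKer_weight HA DK bm).
  rewrite cnt; case: (m =P l) => [ml|_]; last by rewrite addn0.
  by move=> _; apply: h2; rewrite -ml bm orbT.
have am : le a m.
  have := hc m; case: (le a m) => //= /eqP; rewrite -leqn0 leqNgt -has_count => /hasP[].
  by exists s; rewrite ?mem_iota.
have lm := hl m am bm.
case: (m =P l) => [ml|/eqP ml].
  have x0 : x = 0.
    by apply: h2; move: cntt; rewrite cnt ml eqxx addn1 ltnS leqn0 => ->.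
  have [Y YE [_ hY]] := DeltaKer_corner DK bm.
  exists (Y *m X); first exact: pXE.
  split=> [r hr hrc|]; last by rewrite cnt ml eqxx addn1 /= -ml bm.
  have [p hp h] := gen r hr hrc; have [d hd] := hY p hp.
  exists d.
  have hpd : corner b m (p - d *: Y) by rewrite addrC -scaleNr; exact: corner_lin.
  have hin : inA (c s) (r - d *: (Y *m X)).
    rewrite scalemxAl -(subrKA (p *m X)) -mulmxBl; apply: inAD => //.
    exact/(ker _ hpd).
  have hE : corner b a (r - d *: (Y *m X)).
    by rewrite addrC -scaleNr; apply: corner_lin hr; exact: pXE.
  by have [d'] := h1 _ hE hin; rewrite x0 scaler0 subr0.
have labove : above le l m by rewrite /above eq_sym ml.
exists x => //; split=> [r hr hrc|]; last by rewrite cnt (negPf ml) addn0.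
have [p hp h] := gen r hr hrc.
have hE : corner b a (r - p *m X).
  by rewrite addrC -scaleN1r; apply: corner_lin hr; exact: pXE.
have [d hd] := h1 _ hE h; exists d.
rewrite -(subrK (p *m X) r) addrAC; apply: inAD => //.
by have [hpR _ <-] := hp; apply: (ideal_mem HA).
Qed.

(** The kernel is defined by all weights not below l. By [corner_span_above] each e_k A e_l with
    such a k already lies in I_{>l}, so Delta(l) = A e_l / I_{>l} e_l. *)
Lemma DeltaKerE l D X : DeltaKer l D ->
  inA D X <-> inA (ideal (above le l)) X /\ X *m e l = X.
Proof.
move=> DK; have [sD DP _ minD] := DK.
pose W := ideal (above le l) *m lin_mulmxr (e l).
have inW Y : inA W Y <-> inA (ideal (above le l)) Y /\ Y *m e l = Y.
  apply: iff_trans (inA_mulr _ _ _) _; split=> [[Z hZ ->]|[h1 h2]]; last by exists Y.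
  by rewrite -mulmxA (eK HA); split=> //; apply: (ideal_mulr HA) => //; exact: Re.
apply: iff_trans _ (inW X).
have WD : (W <= D)%MS.
  apply: inA_subP => Y /inW[hY <-]; move: Y hY; apply: (ideal_elim HA).
  - by rewrite mul0mx; exact: inA0.
  - by move=> c Y Z hY hZ; rewrite mulmxDl -scalemxAl; exact: inA_lin.
  move=> m u v lm hu _ hv ev; rewrite -mulmxA.
  apply: ((submod_MatP _ _).1 sD) => //.
  apply: (DeltaKer_weight HA DK (above_not_le lm)).
  - by apply: (RM HA) hv _; exact: Re.
  - by rewrite mulmxA ev.
  by rewrite -mulmxA (eK HA).
split; last exact: inA_sub.
apply: inA_sub; apply: minD.
- apply/submod_MatP => Y Z hY /inW[hZ Zl]; apply/inW; rewrite -mulmxA Zl.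
  by split=> //; exact: (ideal_mull HA).
- by apply: inA_subP => Y /inW[hY Yl]; apply/(inPmx HA); split=> //; exact: (ideal_R HA hY).
move=> k kl; apply/eqP; rewrite subn_eq0; apply: mxrankS.
apply: inA_subP => Y /inA_mull[Z /(inPmx HA)[hZ Zl] ->].
have [//|x _ [hx x0]] := @corner_span_above k l l.
have hE : corner k l (e k *m Z).
  split; first by apply: (RM HA) => //; exact: Re.
    by rewrite mulmxA (eK HA).
  by rewrite -mulmxA Zl.
have [c] := hx _ hE; rewrite x0 ?(negPf kl) ?andbF // scaler0 subr0 => hI.
apply/inA_mull; exists (e k *m Z); last by rewrite mulmxA (eK HA).
by apply/inW; rewrite -mulmxA Zl.
Qed.

Lemma iso_Delta_gen M (U W : 'M[K]_(mdim M)) l :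
  is_lmod R M -> submod R M U -> submod R M W -> iso_Delta R e le M U W l ->
  exists x : 'rV_(mdim M),
   [/\ (x <= U)%MS, x *m mact M (e l) = x,
       forall z : 'rV_(mdim M), (z <= U)%MS ->
         exists2 r, inA R r & (z - x *m mact M r <= W)%MS &
       forall r, inA R r -> (x *m mact M r <= W)%MS <-> inA (ideal (above le l)) (r *m e l)].
Proof.
move=> HM sU sW /(iso_DeltaE HA HM sU sW)[D [x [DK xU xl xg xk]]].
exists x; split=> // r hr; rewrite xk //.
apply: iff_trans (DeltaKerE _ DK) _; split=> [[]//|h]; split=> //.
by rewrite -mulmxA (eK HA).
Qed.

(** Each m above a and b labels a factor Delta(m) of P(a), and this factor has weight b. This is the
    count that later turns the spanning layers into a basis. *)
Lemma rank_corner_ge a b :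
  (#|[pred m | le a m && le b m]| <= \rank (Pmx R e a *m mact Mat (e b)))%N.
Proof.
have [t [c [lab [[c0 ct cs cS] hc]]]] := Pmx_filtration a.
have -> : \rank (Pmx R e a *m mact Mat (e b)) = \rank (c t *m mact Mat (e b)).
  by apply/esym/eqmx_rank/eqmxP/eqmxMr/eqmxP.
apply: (@chain_rank _ _ _ _ c (mact Mat (e b)) lab) => [s /cS[]//|m /= /andP[am bm]].
have : has (fun s => lab s == m) (iota 0 t) by rewrite has_count hc am.
case/hasP => s; rewrite mem_iota add0n => /= st /eqP labm.
exists s; split=> //; have [css hD] := cS s st; rewrite labm in hD.
have [D [v [DK vU ve vgen vker]]] := iso_DeltaE HA (Mat_lmod R) (cs s.+1) (cs s) hD.
have [Y [hY bY Ym] [YD _]] := DeltaKer_corner DK bm.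
pose w := v *m mact Mat Y.
have wb : w *m mact Mat (e b) = w by rewrite /w -(act_mul (Mat_lmod R)) ?bY //; exact: Re.
apply/negP => hsub; apply: YD.
have : (w <= c s)%MS.
  rewrite -wb; apply: (@submx_trans _ _ _ _ _ _ (c s *m mact Mat (e b))); last exact: cs (Re HA b).
  apply: submx_trans hsub; apply: submxMr.
  exact: submod_act (cs s.+1) vU hY.
by rewrite vker // Ym.
Qed.

(** In both families the first index is the layer. [yy l k] spans e_k Delta(l), and [xx l k] spans
    its right-module counterpart, e_l A e_k modulo I_{>l}. The last clause normalises the generators
    to 0 where these spaces vanish. *)
Definition layer_generators (xx yy : 'I_n -> 'I_n -> 'M[K]_N) : Prop :=
  [/\ forall l k, corner l k (xx l k), forall l k, corner k l (yy l k),
      forall l k r, corner l k r -> exists c, inA (ideal (above le l)) (r - c *: xx l k),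
      forall l k r, corner k l r -> exists c, inA (ideal (above le l)) (r - c *: yy l k) &
      forall l k, ~~ le k l -> xx l k = 0 /\ yy l k = 0].

Lemma ex_layer_generators : exists xx yy, layer_generators xx yy.
Proof.
have hx l k : exists x, [/\ corner l k x,
   (forall r, corner l k r -> exists c, inA (ideal (above le l)) (r - c *: x)) &
   (~~ le k l -> x = 0)].
  have [//|x h1 [h2 h3]] := @corner_span_above l k l.
  by exists x; split=> // kl; apply: h3; rewrite (negPf kl).
have hy l k : exists x, [/\ corner k l x,
   (forall r, corner k l r -> exists c, inA (ideal (above le l)) (r - c *: x)) &
   (~~ le k l -> x = 0)].
  have [//|x h1 [h2 h3]] := @corner_span_above k l l.
  by exists x; split=> // kl; apply: h3; rewrite (negPf kl) andbF.
have [xx hxx] := fin_all_exists (fun l => fin_all_exists (hx l)).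
have [yy hyy] := fin_all_exists (fun l => fin_all_exists (hy l)).
exists xx, yy; split=> l k.
- by case: (hxx l k).
- by case: (hyy l k).
- by case: (hxx l k).
- by case: (hyy l k).
by move=> kl; case: (hxx l k) => _ _ ->//; case: (hyy l k) => _ _ ->.
Qed.

Lemma ideal_above_top X : inA (ideal (above le top)) X -> X = 0.
Proof. by apply: (ideal_pred0 (HA)); exact: above_top. Qed.

(* A generator of the copy of [Delta b] inside [Delta top = P top]. *)
Lemma ex_eta b : exists h, [/\ corner b top h,
  forall l r, ~~ le l b -> inA R r -> e l *m r *m h = 0 &
  forall a, le a b -> exists2 r, inA R r & e a *m r *m h != 0].
Proof.
have [_ _ _ _ /(_ b)[[Dn [V [Di [[hDn sV] DV VP hDi hiso]]]] _]] := Hq.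
have Dn0 X : inA Dn X -> X = 0.
  by move/(DeltaKerE _ hDn) => [h _]; exact: ideal_above_top.
have hD : iso_Delta R e le Mat V Dn b by exists Di.
have [sDn _ _ _] := hDn.
have [D [x [DK xV xb _ xker]]] := iso_DeltaE HA (Mat_lmod R) sV sDn hD.
pose h := vec_mx x; have xE : x = mxvec h by rewrite vec_mxK.
have eh : e b *m h = h by apply: (can_inj mxvecK); rewrite -mat_act -xE.
have [hR ht] : inA R h /\ h *m e top = h.
  by apply/(inPmx HA); rewrite /inA -xE (submx_trans xV).
have ker p : inA R p -> p *m h = 0 -> inA D (p *m e b).
  by move=> hp h0; rewrite /inA -xker // xE mat_act h0 linear0 sub0mx.
exists h; split=> // [l r lb hr|a ab].
  apply: Dn0; rewrite /inA -mat_act -xE xker; last by apply: (RM HA) => //; exact: Re.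
  apply: (DeltaKer_weight HA DK lb).
  - by do 2?apply: (RM HA) => //; exact: Re.
  - by rewrite !mulmxA (eK HA).
  by rewrite -!mulmxA (eK HA).
have [Y [hY aY Yb] [YD _]] := DeltaKer_corner DK ab.
exists Y => //; rewrite aY; apply/eqP => h0; apply: YD.
by rewrite -Yb; exact: ker.
Qed.

(** Every nonzero submodule of P(i) contains the simple socle, so one fixed vector [s] of weight
    [bot] can be reached from every nonzero element. *)
Lemma ex_socle i : exists s, [/\ s != 0, e bot *m s = s &
  forall x, inA R x -> x *m e i = x -> x != 0 -> exists2 r, inA R r & s = r *m x].
Proof.
have [_ _ _ /(_ i)[[V [sV [_ [VP [[hV1 hV2] hV]]]]] _] _] := Hq.
rewrite mxrank0 subn0 in hV1.
have V0 : V *m mact Mat (e bot) != 0.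
  apply/eqP => h; move: hV2; rewrite /mult h mxrank0 sub0n.
  by [].
(* Induction on the rank: a nonzero submodule missing [V] would be simple, since its proper nonzero
   submodules contain [V] by induction. It would then lie in [V], which has rank 1. *)
have min k : forall U, (\rank U <= k)%N -> submod R Mat U -> (U <= Pmx R e i)%MS ->
    U != 0 -> (V <= U)%MS.
  elim: k => [|k IH] U hr sU UP U0.
    by move: hr; rewrite leqn0 mxrank_eq0 (negPf U0).
  apply/negPn/negP => VU; case/negP: (VU).
  have UV : (U <= V)%MS.
    apply: hV => //; split; first by rewrite /ltmx sub0mx submx0.
    move=> W sW _ WU; case: (eqVneq W 0) => [->|W0]; [left|right]; first by rewrite submx_refl.
    rewrite /eqmx WU /=; apply/negPn/negP => UW; case/negP: VU.
    apply: (submx_trans _ WU); apply: IH => //; last exact: (submx_trans WU UP).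
    by rewrite -ltnS (leq_trans _ hr) // rank_ltmx // /ltmx WU.
  have /mxrank_leqif_sup/geq_leqif <- := UV.
  by rewrite hV1 lt0n mxrank_eq0.
have [j hj] : exists j, row j (V *m mact Mat (e bot)) != 0.
  by case/matrix0Pn: V0 => j [k hjk]; exists j; apply/rV0Pn; exists k; rewrite mxE.
pose s := vec_mx (row j (V *m mact Mat (e bot))).
have hs : inA (V *m mact Mat (e bot)) s by rewrite /inA vec_mxK row_sub.
exists s; split.
- by apply: contra hj => /eqP h; rewrite -[row _ _]vec_mxK -/s h linear0.
- by have /inA_mull[Y _ ->] := hs; rewrite mulmxA (eK HA).
move=> x hx xi x0.
apply/(inAmul R x s); apply: (inA_sub (min _ _ (leqnn _) (Amul_submod HA x) _ _)).
- apply: inA_subP => Y /inAmul[r hr ->]; apply/(inPmx HA).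
  by rewrite -mulmxA xi; split=> //; exact: (RM HA).
- apply/eqP => h; case/eqP: x0; apply: (can_inj mxvecK); rewrite linear0; apply/eqP.
  rewrite -submx0 -h; apply/(inAmul R x x); exists 1%:M; rewrite ?mul1mx //; exact: (R1 HA).
exact: inA_sub (sV _ (Re HA bot)) _ hs.
Qed.

(** * The layer basis of a corner and its compatibility with the ideals *)

Section LayerBasis.
Variables xx yy : 'I_n -> 'I_n -> 'M[K]_N.
Hypothesis Hxy : layer_generators xx yy.

Let xxE l k : corner l k (xx l k). Proof. by case: Hxy. Qed.
Let yyE l k : corner k l (yy l k). Proof. by case: Hxy. Qed.

Definition layer b a m := yy m b *m xx m a.

Lemma layerE b a m : corner b a (layer b a m).
Proof. exact: (corner_mul HA) (yyE m b) (xxE m a). Qed.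

Lemma layer_ideal (U : pred 'I_n) b a m : U m -> inA (ideal U) (layer b a m).
Proof.
by move=> Um; rewrite /layer; have [hy _ <-] := yyE m b; have [hx _ _] := xxE m a;
  exact: (ideal_mem HA).
Qed.

(** Downward induction on the vertex: modulo I_{>l} a product through l is a multiple of the layer
    at l, and the remainder runs through larger vertices, which stay in the up-set [U]. *)
Lemma ideal_span b a (U : pred 'I_n) X : upset le U ->
  inA (ideal U) X -> corner b a X ->
  exists g : 'I_n -> K, X = \sum_(m | U m && (le a m && le b m)) g m *: layer b a m.
Proof.
move=> upU hX XE.
pose sp b a := (\sum_(m | U m && (le a m && le b m)) <<mxvec (layer b a m)>>)%MS.
have cut (V : pred 'I_n) b' a' : (forall m u v, V m -> corner b' m u -> corner m a' v ->
    inA (sp b' a') (u *m v)) -> forall Z, inA (ideal V) Z -> corner b' a' Z -> inA (sp b' a') Z.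
  move=> hV Z hZ [_ <- <-]; move: Z hZ; apply: (ideal_elim HA).
  - by rewrite mulmx0 mul0mx; exact: inA0.
  - move=> c Y Z hY hZ; rewrite mulmxDr mulmxDl -scalemxAr -scalemxAl.
    exact: inA_lin.
  move=> m u v Vm hu um hv mv.
  have -> : e b' *m (u *m v) *m e a' = (e b' *m u) *m (v *m e a') by rewrite !mulmxA.
  apply: (hV m) => //; split.
  - by apply: (RM HA) => //; exact: Re.
  - by rewrite mulmxA (eK HA).
  - by rewrite -mulmxA um.
  - by apply: (RM HA) => //; exact: Re.
  - by rewrite mulmxA mv.
  by rewrite -mulmxA (eK HA).
have main : forall l, U l -> forall b a u v, corner b l u -> corner l a v ->
    inA (sp b a) (u *m v).
  apply: (down_ind Hpo) => l IH Ul b' a' u v hu hv.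
  have [_ _ hxx hyy hz] := Hxy.
  have [c hc] := hyy _ _ _ hu; have [d hd] := hxx _ _ _ hv.
  have hE : corner b' a' (u *m v - (c * d) *: layer b' a' l).
    rewrite addrC -scaleNr; apply: corner_lin (layerE _ _ _) _.
    exact: (corner_mul HA) hu hv.
  have hI : inA (ideal (above le l)) (u *m v - (c * d) *: layer b' a' l).
    have -> : u *m v - (c * d) *: layer b' a' l =
        (u - c *: yy l b') *m v + (c *: yy l b') *m (v - d *: xx l a').
      by rewrite mulmxBl mulmxBr -!scalemxAl -!scalemxAr scalerA addrA subrK.
    apply: inAD; first by apply: (ideal_mulr HA) => //; case: hv.
    by apply: (ideal_mull HA) => //; apply: inAZ; case: (yyE l b').
  have h1 : inA (sp b' a') (u *m v - (c * d) *: layer b' a' l).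
    apply: cut hI hE => m u' v' lm hu' hv'; apply: IH hu' hv' => //.
    by apply: upU Ul _; case/andP: lm.
  rewrite -(subrK ((c * d) *: layer b' a' l) (u *m v)); apply: inAD h1 _.
  apply: inAZ; case: (boolP (le a' l)) => al; last first.
    by rewrite /layer (hz l a' al).1 mulmx0; exact: inA0.
  case: (boolP (le b' l)) => bl; last by rewrite /layer (hz l b' bl).2 mul0mx; exact: inA0.
  by rewrite /inA /sp (sumsmx_sup l) ?genmxE // Ul al bl.
have : inA (sp b a) X by apply: cut hX XE => m u v Um; exact: main.
move/mem_sum_genmx => [g hg]; exists g; apply: (can_inj mxvecK).
by rewrite hg linear_sum; apply: eq_bigr => m _; rewrite linearZ.
Qed.

Lemma corner_ideal b a X : corner b a X -> inA (ideal xpredT) X.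
Proof. by case=> hX bX _; exact: (ideal_e HA (m := b)). Qed.

Lemma corner_span b a X : corner b a X ->
  exists g : 'I_n -> K, X = \sum_(m | le a m && le b m) g m *: layer b a m.
Proof. by move=> h; exact: ideal_span (corner_ideal h) h. Qed.

Lemma layer_independent b a (g : 'I_n -> K) :
  \sum_(m | le a m && le b m) g m *: layer b a m = 0 ->
  forall m, le a m && le b m -> g m = 0.
Proof.
move=> h0; apply: (@spanning_independent _ _ (fun m => le a m && le b m) _
  (fun m => mxvec (layer b a m)) _ (Pmx R e a *m mact Mat (e b))); first last.
- have -> : \sum_(m | le a m && le b m) g m *: mxvec (layer b a m) =
      mxvec (\sum_(m | le a m && le b m) g m *: layer b a m).
    by rewrite linear_sum; apply: eq_bigr => m _; rewrite linearZ.
  by rewrite h0 linear0.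
- exact: rank_corner_ge.
move=> x; rewrite -[x]vec_mxK => /inA_mull[Y /(inPmx HA)[hY Ya] hx].
have hE : corner b a (vec_mx x).
  rewrite hx; split; first by apply: (RM HA) => //; exact: Re.
    by rewrite mulmxA (eK HA).
  by rewrite -mulmxA Ya.
have [g' ->] := corner_span hE; exists g'.
by rewrite linear_sum; apply: eq_bigr => m _; rewrite linearZ.
Qed.

(** [ideal_span] gives a second expansion, supported in [U]; uniqueness of coefficients compares the
    two. Thus one basis serves all the ideals at once. *)
Lemma layer_coef_ideal b a (U : pred 'I_n) (g : 'I_n -> K) : upset le U ->
  inA (ideal U) (\sum_(m | le a m && le b m) g m *: layer b a m) ->
  forall m, le a m && le b m -> ~~ U m -> g m = 0.
Proof.
move=> upU hI m hm Um.
have hE : corner b a (\sum_(m | le a m && le b m) g m *: layer b a m).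
  apply: big_ind => [|X Y hX hY|i _]; first exact: corner0.
    by rewrite -[X]scale1r; exact: corner_lin.
  by rewrite -[_ *: _]addr0; apply: corner_lin (layerE _ _ _) _; exact: corner0.
have [g' hg'] := ideal_span upU hI hE.
have h0 : \sum_(m | le a m && le b m) (g m - (if U m then g' m else 0)) *: layer b a m = 0.
  transitivity (\sum_(m | le a m && le b m) g m *: layer b a m -
     \sum_(m | le a m && le b m) (if U m then g' m else 0) *: layer b a m).
    by rewrite -sumrB; apply: eq_bigr => i _; rewrite scalerBl.
  apply/eqP; rewrite subr_eq0 hg'; apply/eqP.
  rewrite [RHS](bigID U) /= [X in _ = _ + X]big1 ?addr0; last first.
    by move=> i /andP[_ /negPf ->]; rewrite scale0r.
  apply: eq_big => [i|i /andP[-> _]//]; exact: andbC.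
by have := layer_independent h0 hm; rewrite (negPf Um) subr0.
Qed.

Lemma layer_notin b a (U : pred 'I_n) m : upset le U -> ~~ U m -> le a m -> le b m ->
  ~ inA (ideal U) (layer b a m).
Proof.
move=> upU Um am bm hI.
have : inA (ideal U) (\sum_(j | le a j && le b j) (j == m)%:R *: layer b a j).
  rewrite (bigD1 m) ?am //= eqxx scale1r big1 ?addr0 // => j /andP[_ /negPf ->].
  by rewrite scale0r.
move/(layer_coef_ideal upU)/(_ m); rewrite am bm eqxx => /(_ isT Um)/eqP.
by rewrite oner_eq0.
Qed.

Lemma iso_Nabla_mult M (U W : 'M[K]_(mdim M)) l a :
  submod R M U -> iso_Nabla R e le M U W l -> le a l ->
  exists2 z : 'rV_(mdim M), (z <= U)%MS & ~~ (z *m mact M (e a) <= W)%MS.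
Proof.
move=> sU /(iso_NablaE HA sU)[_ _ h] al.
have [h1 h2 h3] := layerE l a l.
apply: h h1 h2 h3 _; apply: layer_notin => //.
- exact: not_below_upset.
- by rewrite (le_refl Hpo).
exact: le_refl.
Qed.

(** Nothing lies above [top], so e_top A e_b is at most a line. Nonvanishing is tested below by
    scalars on this line. *)
Lemma top_corner b r : corner top b r -> exists c, r = c *: xx top b.
Proof.
have [_ _ h _ _] := Hxy; move=> /h[c /ideal_above_top/eqP].
by rewrite subr_eq0 => /eqP ->; exists c.
Qed.

Lemma corner_top b r : corner b top r -> exists c, r = c *: yy top b.
Proof.
have [_ _ _ h _] := Hxy; move=> /h[c /ideal_above_top/eqP].
by rewrite subr_eq0 => /eqP ->; exists c.
Qed.

(** All weights are below [top], so nabla(top) is the whole of I(top), and condition (4) presents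
    nabla(b) as a quotient of the full dual space. *)
Lemma top_quotient b : exists2 V' : 'M[K]_(N * N),
  submod R DMat V' & (Iker K N R n e top <= V')%MS /\ iso_Nabla R e le DMat 1%:M V' b.
Proof.
have [_ _ _ _ /(_ b)[_ [Vn [V' [Vi [[hVn sV'] IV' VV' hVi hiso]]]]]] := Hq.
have Vn1 : (Vn == 1%:M)%MS.
  rewrite /eqmx submx1 /=; case: hVn => _ _ _; apply.
  - by move=> X _; exact: submx1.
  - exact: submx1.
  by move=> k; rewrite le_top.
exists V' => //; split=> //; exists Vi; split=> //.
by apply: (@iso_eqmx _ _ _ DMat DMat _ _ _ _ _ _ Vn1 _ hiso); rewrite submx_refl.
Qed.

(** Otherwise some form does not vanish on [xx top b *m r *m e l]. Cutting it to weight l and then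
    acting by r and e_b gives a form [th] of weight b that is 0 in nabla(b), where weight l is
    absent. As e_top A e_b is a line, [th] spans weight b of I(top), and nabla(b) would have no
    weight b. *)
Lemma xi_kill b l r : ~~ le l b -> inA R r -> xx top b *m r *m e l = 0.
Proof.
move=> lb hr; apply/eqP/negPn/negP => hne.
have [V' sV' [IV' hN]] := top_quotient b.
have s1 : submod R (@DMat K N) 1%:M by move=> X _; exact: submx1.
have [_ hw _] := iso_NablaE HA s1 hN.
have [z _ hz] := iso_Nabla_mult s1 hN (le_refl Hpo b).
have [xR tx xb] := xxE top b.
have : ~~ (mxvec (xx top b *m r *m e l) <= (0 : 'M_(N * N)))%MS.
  by rewrite submx0; apply: contra hne => /eqP h; rewrite -[_ *m e l]mxvecK h linear0.
case/separating_form => psi _ hpsi.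
pose th := psi *m mact DMat (e l) *m mact DMat r *m mact DMat (e b).
have thV : (th <= V')%MS.
  apply: (submod_act sV' _ (Re HA b)); apply: (submod_act sV' _ hr).
  apply: submx_trans (hw l lb); rewrite mul1mx; exact: submxMl.
have thx : th *m (mxvec (xx top b))^T != 0 by rewrite !dmat_act xb.
pose c := (z *m (mxvec (xx top b))^T) 0 0 / (th *m (mxvec (xx top b))^T) 0 0.
have thx0 : (th *m (mxvec (xx top b))^T) 0 0 != 0.
  by apply: contra thx => /eqP h; apply/eqP/matrixP => i j; rewrite !ord1 h mxE.
have hx : z *m (mxvec (xx top b))^T = c *: (th *m (mxvec (xx top b))^T).
  by apply/matrixP => i j; rewrite !ord1 [RHS]mxE /c mulfVK.
have thb : th *m mact DMat (e b) = th.
  by rewrite /th -(act_mul (DMat_lmod R)) ?(eK HA) //; exact: Re.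
case/negP: hz.
have : (z *m mact DMat (e b) - c *: th <= V')%MS.
  apply: submx_trans IV'; apply/(Iker_mem HA) => Y hY tY.
  rewrite mulmxBl -scalemxAl dmat_act -{1}thb dmat_act.
  have [|d ->] := @top_corner b (Y *m e b).
    split; first by apply: (RM HA) => //; exact: Re.
      by rewrite mulmxA tY.
    by rewrite -mulmxA (eK HA).
  by rewrite linearZ /= linearZ /= -!scalemxAr hx !scalerA mulrC subrr.
by move/submxB_eq => ->; exact: scalemx_sub.
Qed.

Lemma xi_ideal b X : inA (ideal (fun m => ~~ le m b)) X -> xx top b *m X = 0.
Proof.
move: X; apply: (ideal_elim HA) => [|c Y Z hY hZ|m u v bm hu <- _ _].
- by rewrite mulmx0.
- by rewrite mulmxDr -scalemxAr hY hZ scaler0 addr0.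
by rewrite !mulmxA xi_kill ?mul0mx.
Qed.

(** The socle of nabla(b) is S(b), so a vector of weight a is moved by some r to a nonzero vector of
    weight b, which is detected on the line of [xx top b]. Since [xx top b] kills I_{>b}, only the
    component of r along [xx b a] matters. *)
Lemma xi_xx b a : le a b -> xx top b *m xx b a != 0.
Proof.
move=> ab; apply/eqP => h0.
have [V' sV' [IV' hN]] := top_quotient b.
have s1 : submod R (@DMat K N) 1%:M by move=> X _; exact: submx1.
have [hs _ _] := iso_NablaE HA s1 hN.
have [z _ hz] := iso_Nabla_mult s1 hN ab.
have [r hr /negP] := hs _ (submx1 _) hz; apply.
apply: submx_trans IV'; apply/(Iker_mem HA) => Y hY tY.
rewrite !dmat_act.
have [|d ->] := @top_corner b (Y *m e b).
  split; first by apply: (RM HA) => //; exact: Re.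
    by rewrite mulmxA tY.
  by rewrite -mulmxA (eK HA).
have [_ _ hxx _ _] := Hxy; have [xR _ xb] := xxE top b.
have [c hc] := hxx b a _ (corner_cut HA b a hr).
have : xx top b *m (e b *m r *m e a - c *: xx b a) = 0.
  by apply: xi_ideal; apply: (ideal_mono HA) hc => m; exact: above_not_le.
rewrite mulmxBr -scalemxAr h0 scaler0 subr0 !mulmxA xb => h.
by rewrite -!scalemxAl h scaler0 !linear0 ?mulmx0.
Qed.

(** * Arrows, the radical and paths going up *)

Section Arrows.
Variable J : 'M[K]_(N * N).
Hypothesis HJ : rad_decomp R e J.

Lemma radical_split X : inA R X -> exists g : 'I_n -> K, inA J (X - \sum_i g i *: e i).
Proof.
have [_ [_ [_ [hR _]]]] := HJ; rewrite /inA (eqmxP hR) => /sub_addsmxP[[u v] /= hX].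
have /mem_sum_genmx[g hg] :
    (u *m (\sum_(i < n) <<mxvec (e i)>>)%MS <= \sum_(i < n) <<mxvec (e i)>>)%MS.
  exact: submxMl.
exists g; rewrite /inA linearB /= hX hg linear_sum /=.
have -> : \sum_i mxvec (g i *: e i) = \sum_i g i *: mxvec (e i).
  by apply: eq_bigr => i _; rewrite linearZ.
by rewrite addrC addrA addNr add0r submxMl.
Qed.

Lemma radical_corner b a X : inA J X -> inA J (e b *m X *m e a).
Proof.
have [_ [hid _]] := HJ => hX.
have h1 : inA J (e b *m X) by case: (hid _ _ (Re HA b) hX).
by case: (hid _ _ (Re HA a) h1).
Qed.

Lemma corner_radical b a X : b != a -> corner b a X -> inA J X.
Proof.
move=> ba [hX bX Xa]; have [g hg] := radical_split hX.
have := radical_corner b a hg; rewrite mulmxBr mulmxBl bX Xa.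
have -> : e b *m (\sum_i g i *: e i) *m e a = 0.
  rewrite mulmx_sumr mulmx_suml big1 // => i _.
  rewrite -scalemxAr -scalemxAl; case: (eqVneq b i) => [<-|bi].
    by rewrite (eK HA) (e_orth HA ba) scaler0.
  by rewrite (e_orth HA bi) mul0mx scaler0.
by rewrite subr0.
Qed.

(** An arrow without component along [xx b a] would lie in I_{>b}, a sum of products through
    vertices m > b. Both factors of such a product are off-diagonal, hence in [J], and the arrow
    would lie in J^2. *)
Lemma xi_arrow a b al : le a b -> a != b -> arrow e J a b al ->
  corner b a al /\ xx top b *m al != 0.
Proof.
move=> ab nab [hJ [hE hJJ]]; have [JR _] := HJ.
have alE : corner b a al by rewrite -hE; apply: corner_cut => //; exact: inA_sub JR _ hJ.
split=> //; have [_ _ hxx _ _] := Hxy; have [c hc] := hxx b a al alE.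
have hcE : corner b a (al - c *: xx b a).
  by rewrite addrC -scaleNr; exact: corner_lin.
have c0 : c != 0.
  apply/eqP => c0; apply: hJJ; move: hc hcE; rewrite c0 scale0r subr0 => hI _.
  have [_ <- <-] := alE; move: al hI {hJ hE alE}; apply: (ideal_elim HA).
  - by rewrite mulmx0 mul0mx; exact: inA0.
  - move=> d Y Z hY hZ; rewrite mulmxDr mulmxDl -scalemxAr -scalemxAl.
    exact: inA_lin.
  move=> m u v /andP[bm bm'] hu um hv mv.
  rewrite mulmxA -mulmxA; apply: mem_mulsp.
    apply: (@corner_radical b m) => //; split.
    - by apply: (RM HA) => //; exact: Re.
    - by rewrite mulmxA (eK HA).
    by rewrite -mulmxA um.
  apply: (@corner_radical m a).
    apply: contraNneq nab => ma; apply/eqP; apply: (le_anti Hpo) => //.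
    by rewrite -ma.
  split.
  - by apply: (RM HA) => //; exact: Re.
  - by rewrite mulmxA mv.
  by rewrite -mulmxA (eK HA).
have h0 : xx top b *m (al - c *: xx b a) = 0.
  by apply: xi_ideal; apply: (ideal_mono HA) hc => m; exact: above_not_le.
move/eqP: h0; rewrite mulmxBr subr_eq0 => /eqP ->.
by rewrite -scalemxAr scaler_eq0 negb_or c0 xi_xx.
Qed.

(** The start [p0] is arbitrary so that the induction can absorb one arrow at a time:
    [xx top w *m al] is a nonzero multiple of [xx top v], which passes nonvanishing along the
    path. *)
Lemma path_corner d lam als v p0 : path (covers le) v lam -> size als = size lam ->
  (forall s, (s < size lam)%N ->
     arrow e J (nth d (v :: lam) s) (nth d lam s) (nth 0 als s)) ->
  corner v bot p0 -> xx top v *m p0 != 0 ->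
  corner (last v lam) bot (foldl (fun p a => a *m p) p0 als) /\
  xx top (last v lam) *m foldl (fun p a => a *m p) p0 als != 0.
Proof.
elim: lam als v p0 => [|w lam IH] [|al als] //= v p0 /andP[vw hp] [hsz] harr h1 h2.
have vw1 : le v w by case/and3P: vw.
have vw2 : v != w by case/and3P: vw.
have [aE anz] := xi_arrow vw1 vw2 (harr 0%N isT).
have xaE : corner top v (xx top w *m al) by exact: (corner_mul HA) aE.
have [c hc] := top_corner xaE.
apply: IH => //; first by move=> s hs; exact: (harr s.+1).
  exact: (corner_mul HA) h1.
rewrite mulmxA hc -scalemxAl scaler_eq0 negb_or h2 andbT.
by apply: contra anz => /eqP c0; rewrite hc c0 scale0r.
Qed.

Lemma pathmx_corner lam als : path (covers le) bot lam -> size als = size lam ->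
  (forall s, (s < size lam)%N ->
     arrow e J (nth bot (bot :: lam) s) (nth bot lam s) (nth 0 als s)) ->
  corner (last bot lam) bot (pathmx e bot als) /\
  xx top (last bot lam) *m pathmx e bot als != 0.
Proof.
move=> h1 h2 h3; apply: path_corner h1 h2 h3 _ _; first exact: corner_e.
have [_ _ ->] := xxE top bot.
(* For the empty up-set, [layer_notin] says that the layer at [top] is nonzero. *)
apply/eqP => h0; apply: (@layer_notin top bot xpred0 top) => //; rewrite ?le_top ?le_refl //.
by rewrite /layer h0 mulmx0; exact: inA0.
Qed.

End Arrows.

(** * Right multiplication by the paths p(1,k,k) *)

Section Paths.
Variable p : 'I_n -> 'M[K]_N.
Hypothesis pE : forall k, corner k bot (p k).
Hypothesis xip : forall k, xx top k *m p k != 0.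

(** [xx top l] kills I_{>l}, so multiplying by it detects the constant; moreover
    [xx top l *m xx l k] is a nonzero multiple of [xx top k], whose product with [p k] is
    nonzero. *)
Lemma xx_path l k : le k l ->
  exists2 c, c != 0 & inA (ideal (above le l)) (xx l k *m p k - c *: xx l bot).
Proof.
move=> kl; have [_ _ hxx _ _] := Hxy.
have [c hc] := hxx l bot _ (corner_mul HA (xxE l k) (pE k)).
exists c => //; apply/eqP => c0.
have : xx top l *m (xx l k *m p k - c *: xx l bot) = 0.
  by apply: xi_ideal; apply: (ideal_mono HA) hc => m; exact: above_not_le.
rewrite c0 scale0r subr0 mulmxA.
have [d hd] := top_corner (corner_mul HA (xxE top l) (xxE l k)).
rewrite hd -scalemxAl => /eqP; rewrite scaler_eq0 (negPf (xip k)) orbF => /eqP d0.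
by have := xi_xx kl; rewrite hd d0 scale0r eqxx.
Qed.

Lemma path_mul_ideal b k (U : pred 'I_n) r : upset le U -> corner b k r ->
  inA (ideal U) (r *m p k) -> inA (ideal U) r.
Proof.
move=> upU hr; have [g ->] := corner_span hr => hI.
apply: inA_sum => m hm; case: (boolP (U m)) => [Um|Um]; first exact/inAZ/layer_ideal.
suff -> : g m = 0 by rewrite scale0r; exact: inA0.
apply/eqP; apply: contraT => gm.
(* Triangularity: [i] is minimal among the vertices outside [U] with nonzero coefficient. Modulo the
   ideal of V = {not <= i} all other terms vanish, and the constant of [xx_path] leaves a nonzero
   multiple of [layer b bot i]. *)
pose Q j := [&& le k j && le b j, ~~ U j & g j != 0].
have Qm : Q m by rewrite /Q hm Um gm.
have [i /and3P[/andP[ki bi] Ui gi] mini] := ex_minimal Hpo Qm.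
pose V := fun j => ~~ le j i.
have upV : upset le V by exact: not_below_upset.
have UV j : U j -> V j by move=> Uj; apply: contra Ui; exact: upU.
have aV j : above le i j -> V j by exact: above_not_le.
have [c c0 hc] := xx_path ki.
have other : inA (ideal V) (\sum_(j | (le k j && le b j) && (j != i)) g j *: layer b k j).
  apply: inA_sum => j /andP[hj ji]; case: (eqVneq (g j) 0) => [->|gj].
    by rewrite scale0r; exact: inA0.
  apply/inAZ/layer_ideal; case: (boolP (U j)) => [/UV //|Uj].
  by apply: contra ji => hji; apply/eqP; apply: mini => //; rewrite /Q hj Uj gj.
have pR : inA R (p k) by case: (pE k).
have hV := ideal_mono HA UV hI.
rewrite (bigD1 i) ?ki ?bi //= mulmxDl in hV.
have h1 := inAB hV (ideal_mulr HA pR other); rewrite addrK -scalemxAl in h1.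
have h2 : inA (ideal V) (yy i b *m (xx i k *m p k - c *: xx i bot)).
  by apply: (ideal_mull HA); [case: (yyE i b) | exact: (ideal_mono HA aV hc)].
have h3 := inAB h1 (inAZ (g i) h2).
rewrite mulmxBr -scalemxAr scalerBr mulmxA opprB addrCA subrr addr0 scalerA in h3.
have h4 := inAZ (g i * c)^-1 h3; rewrite scalerA mulVf ?mulf_neq0 // scale1r in h4.
case: (@layer_notin b bot V i upV _ (le_bot i) bi h4).
by rewrite /V negbK le_refl.
Qed.

End Paths.

(* If [s] spans the socle of [P bot], then [x |-> (r |-> s-coordinate of r *m x)]
   embeds the vectors of weight [a] into the dual of [e bot *m A *m e a]. *)
Lemma rank_bounded_weight a j q (S : 'M[K]_(q, N * N)) :
  (forall x, (mxvec x <= S)%MS -> corner a bot x /\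
     forall m r, ~~ le m j -> inA R r -> e m *m r *m x = 0) ->
  (\rank S <= #|[pred m | le a m && le m j]|)%N.
Proof.
move=> hS; have [s [s0 bs hs]] := ex_socle bot.
have /rV0Pn[k0 hk0] : mxvec s != 0.
  by apply: contra s0 => /eqP h; rewrite -[s]mxvecK h linear0.
pose f : 'cV[K]_(N * N) := delta_mx k0 0.
have fE (X : 'M[K]_N) : (mxvec X *m f) 0 0 = mxvec X 0 k0.
  by rewrite -colE mxE.
(* Only layers through m <= j are paired: the others kill the vectors in question, which generate
   nothing of weight m. *)
pose P := [pred m | le a m && le m j].
pose G := \matrix_(i < N * N, t < #|P|) (lin_mulmx (layer bot a (enum_val t)) *m f) i 0.
have GE X (t : 'I_#|P|) : (mxvec X *m G) 0 t = mxvec (layer bot a (enum_val t) *m X) 0 k0.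
  rewrite -fE -mat_act -mulmxA mxE [RHS]mxE; apply: eq_bigr => i _.
  by rewrite [G i t]mxE.
suff hker : (S :&: kermx G)%MS = 0.
  by rewrite -(mxrank_mul_ker S G) hker mxrank0 addn0 rank_leq_col.
apply/eqP; rewrite -submx0; apply/rV_subP => v.
rewrite sub_capmx -[v]vec_mxK; set x := vec_mx v => /andP[/hS[xE xk] /sub_kermxP hG].
suff -> : x = 0 by rewrite linear0 sub0mx.
apply/eqP; apply: contraT => x0.
have [xR ax xb] := xE; have [r hr hsr] := hs x xR xb x0.
have [g hg] := corner_span (corner_cut HA bot a hr).
have hsx : s = \sum_(m | le a m && le bot m) g m *: (layer bot a m *m x).
  rewrite -bs hsr -{1}ax !mulmxA hg mulmx_suml.
  by apply: eq_bigr => m _; rewrite -scalemxAl.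
have /eqP[] := hk0; rewrite hsx linear_sum summxE big1 // => m /andP[am _].
rewrite linearZ mxE; case: (boolP (le m j)) => mj; last first.
  have [xxR mx _] := xxE m a.
  have -> : layer bot a m *m x = 0.
    by rewrite /layer -mx -!mulmxA (mulmxA (e m)) xk // mulmx0.
  by rewrite linear0 mxE mulr0.
have Pm : m \in P by rewrite inE am.
have := GE x (enum_rank_in Pm m); rewrite hG mxE enum_rankK_in // => <-.
by rewrite mulr0.
Qed.

(** * The cyclic tilting modules inside P(1) *)

Section TiltingGenerator.
Variables (j : 'I_n) (t : 'M[K]_N) (M : amod K N).
Hypothesis HM : is_lmod R M.
Hypothesis Htilt : is_tilting R e le M 1%:M 0 j.
Hypothesis tE : corner bot bot t.
Hypothesis Ht : iso R Mat (Amul R t) 0 M 1%:M 0.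

Lemma tilting_weight m r : ~~ le m j -> inA R r -> e m *m r *m t = 0.
Proof.
move=> mj hr; have [_ _ _ _ /(_ m mj)] := Htilt.
rewrite /mult mul1mx mul0mx mxrank0 subn0 => /eqP; rewrite mxrank_eq0 => /eqP h0.
have [f [fU _ fsurj fker fact]] := isoE Ht.
have hrt : inA (Amul R t) (r *m t) by apply/inAmul; exists r.
have hmrt : inA (Amul R t) (e m *m r *m t).
  by apply/inAmul; exists (e m *m r) => //; apply: (RM HA) => //; exact: Re.
have := fact _ _ _ (Re HA m) hrt; rewrite h0 mulmx0 subr0 mat_act mulmxA fker // submx0.
by move/eqP => h; rewrite -[_ *m t]mxvecK h linear0.
Qed.

Lemma Amul_corner a x : inA R x -> corner a bot (e a *m x *m t).
Proof.
move=> hx; have [tR bt tb] := tE; split.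
- by apply: (RM HA) => //; apply: (RM HA) => //; exact: Re.
- by rewrite !mulmxA (eK HA).
by rewrite -mulmxA tb.
Qed.

(** The vectors are images, under right multiplication by [xx top bot], of generators of the copies
    of Delta(k) in P(top), and inherit from there that they are killed by every m not below k. The
    point is that they lie in A t. *)
Lemma tilting_standard_vectors k : le k j -> exists v,
  [/\ inA (Amul R t) v, e k *m v = v, v != 0 &
      forall m r, ~~ le m k -> inA R r -> e m *m r *m v = 0].
Proof.
have socket l : exists h, [/\ corner l top h, h *m xx top bot != 0,
    forall m r, ~~ le m l -> inA R r -> e m *m r *m h = 0 &
    forall a, le a l -> exists2 r, inA R r & e a *m r *m h != 0].
  have [h [hE h1 h2]] := ex_eta l; exists h; split=> //.
  have [c hc] := corner_top hE.
  have c0 : c != 0.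
    have [r _] := h2 l (le_refl Hpo l); apply: contra => /eqP c0.
    by rewrite hc c0 scale0r mulmx0.
  rewrite hc -scalemxAl scaler_eq0 negb_or c0 /=; apply/eqP => h0.
  apply: (@layer_notin l bot xpred0 top) => //; rewrite ?le_top //.
  by rewrite /layer h0; exact: inA0.
have [tR bt tb] := tE; have [xR tx xb] := xxE top bot.
have [hj [hjE hj0 hjk hjr]] := socket j.
pose vj := hj *m xx top bot.
have vjt : inA (Amul R t) vj.
  have [w [wt we w0]] : exists w, [/\ inA (Amul R t) w, e j *m w = w & w != 0].
    have [_ _ _ hm _] := Htilt; have [f [fU _ fsurj fker fact]] := isoE Ht.
    have [i [i1 hik]] : exists i i1, mact M (e j) i i1 != 0.
      apply/matrix0Pn/eqP => h0; move: hm; rewrite /mult mul1mx h0 mxrank0 //.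
    have [z hz] := fsurj (delta_mx 0 i) (submx1 _).
    rewrite submx0 subr_eq0 => /eqP hzf.
    pose x := vec_mx z; have zE : z = mxvec x by rewrite vec_mxK.
    have := fact _ _ _ (Re HA j) hz; rewrite hzf submx0 subr_eq0 zE mat_act -rowE => /eqP hrow.
    have hx : inA (Amul R t) x by rewrite /inA -zE.
    exists (e j *m x); split.
    - by apply: ((submod_MatP _ _).1 (Amul_submod HA t)) => //; exact: Re.
    - by rewrite mulmxA (eK HA).
    apply/eqP => h0; move: hrow; rewrite h0 linear0 mul0mx => /esym/rowP/(_ i1).
    by rewrite !mxE => h; rewrite h eqxx in hik.
  have [r hr wr] := (inAmul R t w).1 wt.
  have wE : corner j bot w by rewrite -we wr mulmxA; exact: Amul_corner.
  have vE : corner j bot vj by exact: (corner_mul HA) hjE (xxE _ _).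
  (* [w] and [vj] are both vectors of weight j in V_j, and only m = j satisfies j <= m <= j, so
     [rank_bounded_weight] makes them proportional. *)
  pose S := col_mx (mxvec w) (mxvec vj).
  have hS : (\rank S <= 1)%N.
    have hc1 : #|[pred m | le j m && le m j]| = 1%N.
      rewrite (@eq_card1 _ j) // => m; rewrite !inE; apply/andP/eqP => [[h1 h2]|->].
        exact: (le_anti Hpo).
      by rewrite le_refl.
    suff : (\rank S <= #|[pred m | le j m && le m j]|)%N by rewrite hc1.
    apply: rank_bounded_weight => x /submxP[D hD].
    have [c [d ->]] : exists c d, x = c *: w + d *: vj.
      exists (lsubmx D 0 0), (rsubmx D 0 0); apply: (can_inj mxvecK).
      rewrite hD -{1}[D]hsubmxK mul_row_col linearD !linearZ /=.
      by rewrite -!mul_scalar_mx -!mx11_scalar.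
    have vE' : corner j bot (d *: vj).
      by rewrite -[_ *: _]addr0; apply: corner_lin vE _; exact: corner0.
    split=> [|m r' mj hr']; first exact: corner_lin.
    rewrite mulmxDr -!scalemxAr wr mulmxA -(mulmxA (e m)) tilting_weight //; last exact: (RM HA).
    by rewrite /vj mulmxA hjk // mul0mx !scaler0 addr0.
  have hwv : (mxvec vj <= mxvec w)%MS.
    have hw : (mxvec w <= S)%MS by rewrite -addsmxE addsmxSl.
    have : (S <= mxvec w)%MS.
      have /mxrank_leqif_sup/geq_leqif <- := hw; apply: (leq_trans hS).
      rewrite lt0n mxrank_eq0; apply: contra w0 => /eqP h.
      by rewrite -[w]mxvecK h linear0.
    by apply: submx_trans; rewrite -addsmxE addsmxSr.
  exact: submx_trans hwv wt.
(* e_k A e_top is a line on which e_k A [hj] is nonzero, so [hk] is a multiple of an element of A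
   [hj], and its image lies in A [vj]. *)
move=> kj; have [hk [hkE hk0 hkk _]] := socket k.
exists (hk *m xx top bot); split=> //.
- have [r hr hrn] := hjr k kj.
  have hE : corner k top (e k *m r *m hj).
    have [h1 _ h3] := hjE; split; last by rewrite -mulmxA h3.
      by apply: (RM HA) => //; apply: (RM HA) => //; exact: Re.
    by rewrite !mulmxA (eK HA).
  have [c hc] := corner_top hE; have [d ->] := corner_top hkE.
  have c0 : c != 0 by apply: contra hrn => /eqP c0; rewrite hc c0 scale0r.
  have -> : d *: yy top k = (d / c) *: (e k *m r *m hj) by rewrite hc scalerA divfK.
  rewrite -scalemxAl; apply: inAZ; rewrite -mulmxA.
  apply: ((submod_MatP _ _).1 (Amul_submod HA t)) => //.
  by apply: (RM HA) => //; exact: Re.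
- by have [_ <- _] := hkE; rewrite !mulmxA (eK HA).
by move=> m r mk hr; rewrite mulmxA hkk // mul0mx.
Qed.

(** The vector of weight k from [tilting_standard_vectors] enters the nabla-filtration at some
    factor nabla(l). Having weight k there forces k <= l; reaching the socle S(l) from it forces l
    <= k. So nabla(k) occurs for every k <= j, and it has weight a when a <= k. *)
Lemma tilting_rank a :
  (#|[pred k | le a k && le k j]| <= \rank (Amul R t *m mact Mat (e a)))%N.
Proof.
have [_ [T [c [lab [c0 cT cs cS]]]] _ _ _] := Htilt.
have [f [fU _ fsurj fker fact]] := isoE Ht.
apply: (@leq_trans (\rank (c T *m mact M (e a)))); last first.
  apply: (@leq_trans (\rank (mact M (e a)))); first exact: mxrankM_maxr.
  apply: (@leq_trans (\rank (Amul R t *m mact Mat (e a) *m f))); last exact: mxrankM_maxl.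
  apply: mxrankS; apply/row_subP => i; rewrite rowE.
  have [z hz] := fsurj (delta_mx 0 i) (submx1 _).
  rewrite submx0 subr_eq0 => /eqP hzf.
  have := fact _ _ _ (Re HA a) hz; rewrite hzf submx0 subr_eq0 => /eqP <-.
  by do 2!apply: submxMr.
apply: (@chain_rank _ _ _ _ c (mact M (e a)) lab) => [s /cS[]//|k /= /andP[ak kj]].
have [v [vt kv v0 vk]] := tilting_standard_vectors kj.
pose z := mxvec v *m f.
have z0 : z != 0.
  apply: contra v0 => /eqP h; have : (z <= (0 : 'M_(mdim M)))%MS by rewrite h sub0mx.
  by rewrite fker // submx0 => /eqP h'; rewrite -[v]mxvecK h' linear0.
have zX X : inA R X -> z *m mact M X = mxvec (X *m v) *m f.
  by move=> hX; apply/esym/eqP; rewrite -subr_eq0 -submx0 -mat_act; exact: fact.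
have [s [sT hs1 hs2]] : exists s, [/\ (s < T)%N, ~~ (z <= c s)%MS & (z <= c s.+1)%MS].
  have : exists s, (z <= c s)%MS by exists T; rewrite (eqmxP cT) submx1.
  move=> hex; case: (ex_minnP hex) => -[|s] hs hmin.
    by move: hs; rewrite (eqmxP c0) submx0 (negPf z0).
  have hsT : (s < T)%N by apply: hmin; rewrite (eqmxP cT) submx1.
  exists s; split=> //; apply/negP => /hmin; by rewrite ltnn.
have [css hN] := cS s sT.
have [hsoc hw _] := iso_NablaE HA (cs s.+1) hN.
have kl : le k (lab s).
  apply: contraT => /hw h; case/negP: hs1.
  have <- : z *m mact M (e k) = z by rewrite zX ?kv //; exact: Re.
  exact: submx_trans (submxMr _ hs2) h.
have lk : le (lab s) k.
  apply: contraT => lk; have [r hr] := hsoc _ hs2 hs1.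
  rewrite -(act_mul HM) //; last exact: Re.
  rewrite zX; last by apply: (RM HA) => //; exact: Re.
  by rewrite vk // linear0 mul0mx sub0mx.
have labk : lab s = k by exact: (le_anti Hpo).
exists s; split=> //; rewrite labk in hN.
have [z' hz' hz'n] := iso_Nabla_mult (cs s.+1) hN ak.
apply/negP => hsub; case/negP: hz'n.
apply: submx_trans (submxMr _ hz') _; apply: submx_trans hsub _.
exact: cs (Re HA a).
Qed.

(** The layers through m <= j, applied to t, span e_a A t because the others kill t. By
    [tilting_rank] there are no more of them than the dimension, so they satisfy no relation. *)
Lemma tilting_annihilator a r : corner a bot r -> r *m t = 0 ->
  inA (ideal (fun m => ~~ le m j)) r.
Proof.
move=> hr hrt; have [g hg] := corner_span hr.
have kill m : ~~ le m j -> layer a bot m *m t = 0.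
  move=> mj; have [xR mx _] := xxE m bot.
  by rewrite /layer -mx -!mulmxA (mulmxA (e m)) tilting_weight // mulmx0.
have hind := @spanning_independent _ _ [pred k | le a k && le k j] _
  (fun m => mxvec (layer a bot m *m t)) _ (Amul R t *m mact Mat (e a)) _ (tilting_rank a).
have : forall m, le a m && le m j -> g m = 0.
  apply: hind => [x|].
    rewrite -[x]vec_mxK => /inA_mull[Y /inAmul[q hq ->] ->].
    have [tR bt tb] := tE.
    have [g' hg'] := corner_span (corner_cut HA a bot hq).
    exists g'; rewrite mulmxA -{1}bt mulmxA hg' mulmx_suml linear_sum.
    rewrite (bigID (fun m => le m j)) /= [X in _ + X]big1 ?addr0; last first.
      by move=> m /andP[_ mj]; rewrite -scalemxAl kill // scaler0 linear0.
    apply: eq_big => [m|m _]; first by rewrite le_bot.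
    by rewrite -scalemxAl linearZ.
  have -> : \sum_(i | [pred k | le a k && le k j] i) g i *: mxvec (layer a bot i *m t) =
      mxvec (r *m t); last by rewrite hrt linear0.
  rewrite hg mulmx_suml linear_sum.
  rewrite [RHS](bigID (fun m => le m j)) /= [X in _ + X]big1 ?addr0; last first.
    by move=> m /andP[_ mj]; rewrite -scalemxAl kill // scaler0 linear0.
  apply: eq_big => [m|m _]; first by rewrite le_bot.
  by rewrite -scalemxAl linearZ.
move=> g0; rewrite hg; apply: inA_sum => m /andP[_ am].
case: (boolP (le m j)) => mj; last by apply/inAZ/layer_ideal.
by rewrite g0 ?am // scale0r; exact: inA0.
Qed.

End TiltingGenerator.

End LayerBasis.

End OneQuasiHereditary.

(** * Local submodules and filtrations *)

Section LocalSubmodules.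
Variables (K : fieldType) (N n : nat) (R : 'M[K]_(N * N)).
Variables (e : 'I_n -> 'M[K]_N) (J : 'M[K]_(N * N)).
Hypothesis HA : basic_alg R e.
Hypothesis HJ : rad_decomp R e J.

Lemma radical_R X : inA J X -> inA R X.
Proof. by have [JR _] := HJ; exact: inA_sub. Qed.

(** Iterating z = j z modulo [S] replaces j by its powers, and j is nilpotent. The iterate of order
    m is the power m+1 of j, in step with the shift in [powsp]. *)
Lemma nakayama (S : 'M[K]_(N * N)) j z : submod R Mat S -> inA J j ->
  inA S (z - j *m z) -> inA S z.
Proof.
move=> sS hj hz; have [_ [_ [[m /eqmxP hm] _]]] := HJ.
have jR := radical_R hj.
have pw s : inA (powsp J s) (iter s (mulmx j) j).
  by elim: s => //= s IH; exact: mem_mulsp.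
have hit s : inA S (z - iter s (mulmx j) j *m z).
  elim: s => [//|s IH] /=.
  rewrite -(subrKA (j *m z)) -mulmxA -mulmxBr; apply: inAD => //.
  exact: (submod_MatP _ _).1 sS _ _ jR IH.
have := hit m; have -> : iter m (mulmx j) j = 0.
  have := pw m; rewrite /inA hm submx0 => /eqP h.
  by apply: (can_inj mxvecK); rewrite h linear0.
by rewrite mul0mx subr0.
Qed.

(** The unique maximal submodule is J t: since t has weight k, an element of A t outside J t is a
    nonzero multiple of t modulo J t, and [nakayama] recovers t from it. *)
Lemma Amul_local k t : e k *m t = t -> t != 0 -> local_sq R Mat (Amul R t) 0.
Proof.
move=> kt t0; have [_ [Jid _]] := HJ.
pose V := J *m lin_mulmxr t.
have inV Y : inA V Y <-> exists2 j, inA J j & Y = j *m t := inA_mulr J t Y.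
have sV : submod R Mat V.
  apply/submod_MatP => X Y hX /inV[j hj ->]; apply/inV; exists (X *m j); last by rewrite mulmxA.
  by case: (Jid _ _ hX hj).
have tU : inA (Amul R t) t by apply/inAmul; exists 1%:M; rewrite ?mul1mx //; exact: (R1 HA).
have tV : ~ inA V t.
  case/inV => j hj hjt; case/eqP: t0; apply: (can_inj mxvecK); rewrite linear0; apply/eqP.
  rewrite -submx0; apply: (@nakayama 0 j) => //; first exact: zero_submod.
  by rewrite -hjt subrr; exact: inA0.
have UV (Y : 'M[K]_(N * N)) : submod R Mat Y -> (Y <= Amul R t)%MS -> ~ inA Y t -> (Y <= V)%MS.
  move=> sY YU Yt; apply: inA_subP => y hy.
  have /inAmul[r hr ry] : inA (Amul R t) y by exact: inA_sub YU _ hy.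
  have [g hg] := radical_split HJ hr.
  have hy' : y = g k *: t + (r - \sum_i g i *: e i) *m t.
    have hsum : (\sum_i g i *: e i) *m t = g k *: t.
      rewrite mulmx_suml (bigD1 k) //= -scalemxAl kt big1 ?addr0 // => i ik.
      by rewrite -scalemxAl -kt mulmxA (e_orth HA ik) mul0mx scaler0.
    by rewrite mulmxBl hsum -ry addrC subrK.
  case: (eqVneq (g k) 0) => [gk|gk].
    by apply/inV; rewrite hy' gk scale0r add0r; eexists; [exact: hg|].
  case: Yt; apply: (@nakayama Y (- (g k)^-1 *: (r - \sum_i g i *: e i))) => //.
    exact: inAZ.
  rewrite scaleNr mulNmx opprK -scalemxAl.
  have -> : t + (g k)^-1 *: ((r - \sum_i g i *: e i) *m t) = (g k)^-1 *: y.
    by rewrite hy' scalerDr scalerA mulVf // scale1r.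
  exact: inAZ.
have VU : (V <= Amul R t)%MS.
  by apply: inA_subP => Y /inV[j hj ->]; apply/inAmul; exists j => //; exact: radical_R.
have tsub (Y : 'M[K]_(N * N)) : submod R Mat Y -> inA Y t -> (Amul R t <= Y)%MS.
  move=> sY tY; apply: inA_subP => y /inAmul[r hr ->].
  exact: (submod_MatP _ _).1 sY _ _ hr tY.
exists V; split=> //; split; first exact: sub0mx.
split; first split.
- by rewrite /ltmx VU; apply/negP => h; apply: tV; exact: inA_sub h _ tU.
- move=> W sW VW WU; case: (boolP (mxvec t <= W)%MS) => [tW|/negP tW].
    by right; rewrite /eqmx WU tsub.
  by left; rewrite /eqmx VW UV.
move=> V' sV' _ [/andP[V'U UV'] hV'].
have V'V : (V' <= V)%MS.
  by apply: UV => // tV'; case/negP: UV'; exact: tsub.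
case: (hV' V sV V'V VU) => [/andP[VV' _]|/andP[_ UV'']].
  by rewrite /eqmx V'V.
by case: tV; exact: inA_sub UV'' _ tU.
Qed.

(** A submodule not contained in the maximal submodule [V] is all of [U]: a proper one of largest
    rank would be a second maximal submodule. Hence any weight vector outside [V] generates. *)
Lemma local_generated U : submod R Mat U -> local_sq R Mat U 0 ->
  exists k u, [/\ inA U u, e k *m u = u & (U <= Amul R u)%MS].
Proof.
move=> sU [V [sV [_ [[/andP[VU UV] hV] Vuniq]]]].
have [k [u [uU ku uV]]] : exists k u, [/\ inA U u, e k *m u = u & ~ inA V u].
  have /row_subPn[i hi] := UV; pose x := vec_mx (row i U).
  have xU : inA U x by rewrite /inA vec_mxK row_sub.
  have [k hk] : exists k, ~~ (mxvec (e k *m x) <= V)%MS.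
    apply/existsP; apply: contraR hi; rewrite negb_exists => /forallP h.
    rewrite -[row i U]vec_mxK -/x -(mul1mx x) -(sum_e HA) mulmx_suml.
    by apply: inA_sum => k _; have := h k; rewrite negbK.
  exists k, (e k *m x); split; last exact/negP.
    exact: ((submod_MatP _ _).1 sU _ _ (Re HA k) xU).
  by rewrite mulmxA (eK HA).
exists k, u; split=> //.
have gen d : forall X, (\rank U - \rank X <= d)%N -> submod R Mat X -> (X <= U)%MS ->
    ~~ (X <= V)%MS -> (U <= X)%MS.
  elim: d => [|d IH] X hd sX XU XV.
    by move: hd; rewrite leqn0 => /eqP; exact: rank1_subR.
  apply/negPn/negP => UX; case/negP: (XV).
  suff : simple_sq K N R Mat U X by move=> hs; case/andP: (Vuniq X sX (sub0mx _ _) hs).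
  split; first by rewrite /ltmx XU.
  move=> W sW XW WU; case: (boolP (W <= X)%MS) => [WX|WX]; first by left; apply/andP.
  right; apply/andP; split=> //; apply: IH => //.
    have hlt : (\rank X < \rank W)%N by rewrite rank_ltmx // /ltmx XW.
    rewrite leq_subLR; move: hd; rewrite leq_subLR => hd.
    by apply: (leq_trans hd); rewrite addnS -addSn leq_add2r.
  by apply: contra XV; exact: submx_trans.
apply: (gen _ _ (leqnn _) (Amul_submod HA u)).
- apply: inA_subP => y /inAmul[r hr ->].
  exact: (submod_MatP _ _).1 sU _ _ hr uU.
apply/negP => h; apply: uV; apply: inA_sub h _ _.
by apply/inAmul; exists 1%:M; rewrite ?mul1mx //; exact: (R1 HA).
Qed.

End LocalSubmodules.

(** * Assembling Delta-filtrations step by step *)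

Section Filtrations.
Variables (K : fieldType) (N n : nat) (R : 'M[K]_(N * N)).
Variables (e : 'I_n -> 'M[K]_N) (le : rel 'I_n) (M : amod K N).
Local Notation inF := (inF R (iso_Delta R e le) M).

Lemma inF_zero (i : 'I_n) (U : 'M[K]_(mdim M)) : U = 0 -> inF U 0.
Proof.
move=> ->; exists 0%N, (fun=> 0), (fun=> i).
by split=> //; [rewrite submx_refl | rewrite submx_refl | move=> s; exact: zero_submod].
Qed.

Lemma inF_eqmx (U U' : 'M[K]_(mdim M)) : (U == U')%MS -> inF U 0 -> inF U' 0.
Proof.
move=> /eqmxP UU' [t [c [lab [h1 h2 h3 h4]]]]; exists t, c, lab; split=> //.
by apply/eqmxP; apply: eqmx_trans (eqmxP h2) UU'.
Qed.

Lemma inF_step (U W : 'M[K]_(mdim M)) l : submod R M U ->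
  (W <= U)%MS -> iso_Delta R e le M U W l -> inF W 0 -> inF U 0.
Proof.
move=> sU WU [D [hD hiso]] [t [c [lab [h1 h2 h3 h4]]]].
exists t.+1, (fun s => if (s <= t)%N then c s else U), (fun s => if (s < t)%N then lab s else l).
split=> //.
- by rewrite ltnn submx_refl.
- by move=> s; case: ifP.
move=> s; rewrite ltnS; case: ltngtP => // [st _|-> _]; first exact: h4.
split; first by rewrite (eqmxP h2).
exists D; split=> //; apply: iso_eqmx hiso; first by rewrite submx_refl.
by apply/eqmxP/eqmx_sym/eqmxP.
Qed.

End Filtrations.

(** * The family t(i,k) *)

Section TiltingFamily.
Variables (K : fieldType) (N n : nat) (R : 'M[K]_(N * N)).
Variables (e : 'I_n -> 'M[K]_N) (le : rel 'I_n) (bot top : 'I_n).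
Hypothesis Hq : one_qh R e le bot top.
Variables xx yy : 'I_n -> 'I_n -> 'M[K]_N.
Hypothesis Hxy : layer_generators R e le xx yy.

Let HA : basic_alg R e. Proof. by case: Hq => -[]. Qed.
Let Hpo : partial_order n le. Proof. by case: Hq => -[_ []]. Qed.
Let xxE l k : corner R e l k (xx l k). Proof. by case: Hxy. Qed.
Let yyE l k : corner R e k l (yy l k). Proof. by case: Hxy. Qed.
Local Notation corner := (corner R e).
Local Notation ideal := (ideal R e).
Local Notation not_below i := (fun m => ~~ le m i).

Let upNB i : upset le (not_below i). Proof. exact: not_below_upset. Qed.

(** Abstract data: [tw] bounds the weights of A t(i,k), and [tann] is the inclusion of annihilators
    that comes from the tilting modules and the path multiplication. *)
Variable t : 'I_n -> 'I_n -> 'M[K]_N.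
Hypothesis tE : forall i k, corner k bot (t i k).
Hypothesis tw : forall i k m r, ~~ le m i -> inA R r -> e m *m r *m t i k = 0.
Hypothesis tann : forall i k b r, corner b k r -> r *m t i k = 0 ->
  inA (ideal (not_below i)) r.

Lemma sum_corners S r : (forall b, inA S (e b *m r)) -> inA S r.
Proof.
by move=> h; rewrite -(mul1mx r) -(sum_e HA) mulmx_suml; exact: inA_sum.
Qed.

Lemma corner_left b k r : inA R r -> r *m e k = r -> corner b k (e b *m r).
Proof.
move=> hr rk; split; first by apply: (RM HA) => //; exact: Re.
  by rewrite mulmxA (eK HA).
by rewrite -mulmxA rk.
Qed.

Lemma t_annihilator i k r : inA R r -> r *m e k = r ->
  r *m t i k = 0 <-> inA (ideal (not_below i)) r.
Proof.
move=> hr rk; split=> h; last by move: r h {hr rk}; apply: (ideal_kill HA) => m r; exact: tw.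
apply: sum_corners => b; apply: (tann (corner_left b hr rk)).
by rewrite -mulmxA h mulmx0.
Qed.

Lemma xx_t i k : le k i -> xx i k *m t i k != 0.
Proof.
move=> ki; apply/eqP => h0; have hI := tann (xxE i k) h0.
have [yR _ _] := yyE i i.
have nl : ~~ not_below i i by rewrite negbK le_refl.
exact: (layer_notin Hq Hxy (@upNB i) nl ki (le_refl Hpo i) (ideal_mull HA yR hI)).
Qed.

Lemma t_neq0 i k : le k i -> t i k != 0.
Proof. by move/xx_t; apply: contra => /eqP ->; rewrite mulmx0. Qed.

(** The layers through m with k <= m <= i, applied to t(i,k), are independent and as many as the
    bound on the dimension of e_k V_i. Adjoining [x] cannot enlarge their span. *)
Lemma t_cover i k x : le k i -> corner k bot x ->
  (forall m r, ~~ le m i -> inA R r -> e m *m r *m x = 0) ->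
  inA (Amul R (t i k)) x.
Proof.
move=> ki xE xw.
pose P := [pred m | le k m && le m i].
pose v m := mxvec (layer xx yy k k m *m t i k).
pose S := ((\sum_(m | P m) <<v m>>) + mxvec x)%MS.
have vS m : P m -> (v m <= S)%MS.
  move=> Pm; rewrite /S; apply: submx_trans (addsmxSl _ _).
  by rewrite (sumsmx_sup m) // genmxE.
have xS : (mxvec x <= S)%MS.
  exact: addsmxSr.
have lE m : corner k bot (layer xx yy k k m *m t i k).
  exact: (corner_mul HA) (layerE Hq Hxy k k m) (tE i k).
have hr : (\rank S <= #|P|)%N.
  apply: (rank_bounded_weight Hq Hxy) => z /sub_addsmxP[[a b] /= hz].
  have [g hg] : exists g : 'I_n -> K, a *m (\sum_(m | P m) <<v m>>)%MS = \sum_(m | P m) g m *: v m.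
    by apply/mem_sum_genmx; exact: submxMl.
  have [c hc] : exists c, b *m mxvec x = c *: mxvec x.
    by apply/sub_rVP; exact: submxMl.
  have -> : z = \sum_(m | P m) g m *: (layer xx yy k k m *m t i k) + c *: x.
    apply: (can_inj mxvecK); rewrite hz hg hc linearD linear_sum linearZ /=.
    by congr (_ + _); apply: eq_bigr => m _; rewrite linearZ.
  split=> [|m r mi hr].
    rewrite addrC; apply: corner_lin xE _.
    apply: big_ind => [|X Y hX hY|m _]; first exact: corner0.
      by rewrite -[X]scale1r; exact: corner_lin.
    by rewrite -[_ *: _]addr0; apply: corner_lin (lE m) _; exact: corner0.
  rewrite mulmxDr -scalemxAr xw // scaler0 addr0 mulmx_sumr big1 // => l _.
  rewrite -scalemxAr mulmxA -(mulmxA (e m)) tw ?scaler0 //.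
  by apply: (RM HA) => //; case: (layerE Hq Hxy k k l).
have hind : independent P v.
  move=> g; rewrite /v => h0 m Pm.
  have hI : inA (ideal (not_below i))
      (\sum_(m | le k m && le k m) (if le m i then g m else 0) *: layer xx yy k k m).
    apply: (tann (b := k)).
      apply: big_ind => [|X Y hX hY|l _]; first exact: corner0.
        by rewrite -[X]scale1r; exact: corner_lin.
      by rewrite -[_ *: _]addr0; apply: corner_lin (layerE Hq Hxy k k l) _; exact: corner0.
    apply: (can_inj mxvecK); rewrite linear0 -h0 mulmx_suml linear_sum.
    rewrite (bigID (fun l => le l i)) /= [X in _ + X]big1 ?addr0; last first.
      by move=> l /andP[_ /negPf ->]; rewrite scale0r mul0mx linear0.
    apply: eq_big => [l|l /andP[_ ->]]; first by rewrite andbb.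
    by rewrite -scalemxAl linearZ.
  have /andP[km mi] := Pm.
  have := layer_coef_ideal Hq Hxy (@upNB i) hI (m := m).
  by rewrite km mi => ->.
have [g hg] := independent_spanning vS hind hr xS.
rewrite /inA hg; apply: summx_sub => m _; apply: scalemx_sub.
by apply/inAmul; exists (layer xx yy k k m) => //; case: (layerE Hq Hxy k k m).
Qed.

(** Let j be a maximal index with nonzero coefficient. Multiplication by [xx j k] kills every other
    term: its index l is not above j, so A t(l,k) has no weight j. *)
Lemma t_independent k (g : 'I_n -> K) :
  \sum_(i | le k i) g i *: t i k = 0 -> forall i, le k i -> g i = 0.
Proof.
move=> h0 i ki; apply/eqP; apply: contraT => gi.
have Qi : le k i && (g i != 0) by rewrite ki.
have [j [/andP[kj gj] _ hj]] := ex_maximal Hpo (P := fun i => le k i && (g i != 0)) Qi.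
have := congr1 (mulmx (xx j k)) h0; rewrite mulmx0 mulmx_sumr (bigD1 j) //= big1.
  by rewrite addr0 -scalemxAr => /eqP; rewrite scaler_eq0 (negPf gj) (negPf (xx_t kj)).
move=> l /andP[kl lj]; case: (eqVneq (g l) 0) => [->|gl]; first by rewrite scale0r mulmx0.
have jl : ~~ le j l by apply: contra lj => jl; apply/eqP; apply: hj => //; rewrite kl.
have [xR jx _] := xxE j k.
by rewrite -scalemxAr -jx tw ?scaler0.
Qed.

Lemma t_span k x : corner k bot x -> exists g : 'I_n -> K, x = \sum_(i | le k i) g i *: t i k.
Proof.
move=> xE; pose P := [pred m | le bot m && le k m].
pose S := (\sum_(m | P m) <<mxvec (layer xx yy k bot m)>>)%MS.
have hS y : corner k bot y -> (mxvec y <= S)%MS.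
  move=> /(corner_span Hq Hxy)[g ->]; apply/mem_sum_genmx; exists g.
  by rewrite linear_sum; apply: eq_bigr => m _; rewrite linearZ.
have [|g hg] := @independent_spanning _ _ P _ (fun i => mxvec (t i k)) _ S
   (fun i _ => hS _ (tE i k)) _ (rank_sum_genmx _ _) _ (hS x xE).
  move=> g h0 i /andP[_ ki]; apply: (t_independent (k := k)) => //.
  apply: (can_inj mxvecK); rewrite linear0 -h0 linear_sum.
  by apply: eq_big => [j|j _]; [rewrite /= (le_bot Hq) | rewrite linearZ].
exists g; apply: (can_inj mxvecK); rewrite hg linear_sum.
by apply: eq_big => [j|j _]; [rewrite /= (le_bot Hq) | rewrite linearZ].
Qed.

Lemma t_family_independent (c : 'I_n -> 'I_n -> K) :
  \sum_(i < n) \sum_(k < n | le k i) c i k *: t i k = 0 ->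
  forall i k, le k i -> c i k = 0.
Proof.
move=> h0 i k ki; apply: (t_independent (k := k) (g := c^~ k)) => //.
have hk := congr1 (mulmx (e k)) h0; rewrite mulmx0 mulmx_sumr in hk.
rewrite -[RHS]hk [LHS]big_mkcond /=; apply: eq_bigr => j _; rewrite mulmx_sumr.
have z l : l != k -> e k *m (c j l *: t j l) = 0.
  move=> lk; have [_ <- _] := tE j l.
  by rewrite -scalemxAr mulmxA (e_orth HA) ?mul0mx ?scaler0 // eq_sym.
case: (boolP (le k j)) => kj.
  rewrite (bigD1 k) //= big1 ?addr0; last by move=> l /andP[_ lk]; exact: z.
  by have [_ kt _] := tE j k; rewrite -scalemxAr kt.
by rewrite big1 // => l lj; apply: z; apply: contraNneq kj => <-.
Qed.

Lemma t_family_span X : inA (Pmx R e bot) X ->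
  exists c : 'I_n -> 'I_n -> K, X = \sum_(i < n) \sum_(k < n | le k i) c i k *: t i k.
Proof.
move=> /(inPmx HA)[hX Xb].
have h k : exists g : 'I_n -> K, e k *m X = \sum_(i | le k i) g i *: t i k.
  by apply: t_span; exact: corner_left.
have [g hg] := fin_all_exists h; exists (fun i k => g k i).
rewrite -{1}(mul1mx X) -(sum_e HA) mulmx_suml.
rewrite (eq_bigr _ (fun k _ => hg k)) (exchange_big_dep xpredT) //=.
Qed.

(** The image of t(i,k) is killed by whatever kills t(i,k), so [t_cover] brings it back into A
    t(i,k). *)
Lemma t_invariant (F : 'M[K]_(N * N)) i k : (Pmx R e bot *m F <= Pmx R e bot)%MS ->
  (forall X, inA R X -> Pmx R e bot *m (mact Mat X *m F - F *m mact Mat X) = 0) ->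
  le k i -> (Amul R (t i k) *m F <= Amul R (t i k))%MS.
Proof.
move=> FP Fact ki; have [tR kt tb] := tE i k.
have tP : inA (Pmx R e bot) (t i k) by apply/(inPmx HA).
pose y := vec_mx (mxvec (t i k) *m F).
have yE : mxvec (t i k) *m F = mxvec y by rewrite vec_mxK.
have act X : inA R X -> mxvec (X *m t i k) *m F = mxvec (X *m y).
  move=> hX; apply/eqP; rewrite -!mat_act -yE -subr_eq0 -!mulmxA -mulmxBr.
  by have /submxP[d ->] := tP; rewrite -mulmxA Fact ?mulmx0.
have act0 X : inA R X -> X *m t i k = 0 -> X *m y = 0.
  by move=> hX h0; apply: (can_inj mxvecK); rewrite -act // h0 !linear0 mul0mx.
have /(inPmx HA)[yR yb] : inA (Pmx R e bot) y.
  by rewrite /inA -yE; apply: submx_trans FP; exact: submxMr.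
have ky : e k *m y = y.
  by apply: (can_inj mxvecK); rewrite -act ?kt //; exact: Re.
have hy : inA (Amul R (t i k)) y.
  apply: t_cover => // m r mi hr; apply: act0; last exact: tw.
  by apply: (RM HA) => //; exact: Re.
apply/row_subP => s; rewrite row_mul.
have /inAmul[r hr hrow] : inA (Amul R (t i k)) (vec_mx (row s (Amul R (t i k)))).
  by rewrite /inA vec_mxK row_sub.
rewrite -[row s _]vec_mxK hrow act //.
exact: ((submod_MatP _ _).1 (Amul_submod HA (t i k)) _ _ hr hy).
Qed.

(** The filtration consists of the I_U t(i,k), where [U] loses one minimal vertex l at a time. The
    factor is generated by [xx l k *m t i k]; it is Delta(l) for k <= l <= i and 0 otherwise. *)
Lemma t_filtered i k : le k i -> inF R (iso_Delta R e le) Mat (Amul R (t i k)) 0.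
Proof.
move=> ki; have [tR kt tb] := tE i k; set t0 := t i k in tR kt tb *.
pose S (U : pred 'I_n) := ideal U *m lin_mulmxr t0.
have inS U Y : inA (S U) Y <-> exists2 z, inA (ideal U) z & Y = z *m t0 := inA_mulr _ _ _.
have sS U : submod R Mat (S U).
  apply/submod_MatP => X Y hX /inS[z hz ->]; apply/inS.
  by exists (X *m z); [exact: (ideal_mull HA) | rewrite mulmxA].
suff H d : forall U : pred 'I_n, (#|U| <= d)%N -> upset le U ->
    inF R (iso_Delta R e le) Mat (S U) 0.
  apply: inF_eqmx (H _ xpredT (leqnn _) (fun _ _ _ _ => isT)); apply/andP; split.
    by apply: inA_subP => Y /inS[z /(ideal_R HA) hz ->]; apply/inAmul; exists z.
  apply: inA_subP => Y /inAmul[z hz ->]; apply/inS; exists z => //.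
  by apply: sum_corners => b; apply: (ideal_e HA (m := b)); rewrite ?mulmxA ?(eK HA) //;
    apply: (RM HA) => //; exact: Re.
elim: d => [|d IH] U hU upU.
  apply: (@inF_zero _ _ _ _ _ _ _ k); apply/eqP; rewrite -submx0.
  apply: inA_subP => Y /inS[z hz ->].
  rewrite (ideal_pred0 HA _ hz) ?mul0mx; first exact: inA0.
  move=> m; apply/negP => Um; have Um' : m \in U by [].
  by move: hU; rewrite leqn0 => /eqP/card0_eq/(_ m); rewrite Um'.
case: (pickP U) => [l0 Ul0|U0]; last first.
  by apply: IH => //; rewrite leqNgt; apply/negP => h; move: h; rewrite (eq_card0 U0).
have [l Ul minl] := ex_minimal Hpo Ul0.
pose U' m := U m && (m != l).
have upU' : upset le U'.
  move=> a b /andP[Ua al] ab; rewrite /U' (upU _ _ Ua ab) /=.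
  by apply: contra al => /eqP bl; apply/eqP; apply: minl => //; rewrite -bl.
have aU' m : above le l m -> U' m.
  by case/andP => lm lem; rewrite /U' (upU _ _ Ul lem) eq_sym.
have hU' : (#|U'| <= d)%N.
  rewrite -ltnS (leq_trans _ hU) //; apply: proper_card; apply/properP; split.
    by apply/subsetP => m /andP[].
  by exists l => //; rewrite unfold_in /U' eqxx andbF.
have inF' := IH U' hU' upU'.
have S'S : (S U' <= S U)%MS.
  apply: inA_subP => Y /inS[z hz ->]; apply/inS; exists z => //.
  by apply: (ideal_mono HA) hz => m /andP[].
(* Modulo I_{U'} only products through l survive, and their right factors are multiples of
   [xx l k]. *)
have dec z : inA (ideal U) z -> exists s,
    [/\ inA R s, s *m e l = s & inA (S U') (z *m t0 - s *m xx l k *m t0)].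
  move: z; apply: (ideal_elim HA) => [|c Y Z [s1 [h1 h2 h3]] [s2 [g1 g2 g3]]|m u v Um hu um hv mv].
  - exists 0; split; [exact: inA0 | exact: mul0mx |].
    by rewrite !mul0mx subrr; exact: inA0.
  - exists (c *: s1 + s2); split; first exact: inA_lin.
      by rewrite mulmxDl -scalemxAl h2 g2.
    have -> : (c *: Y + Z) *m t0 - (c *: s1 + s2) *m xx l k *m t0 =
        c *: (Y *m t0 - s1 *m xx l k *m t0) + (Z *m t0 - s2 *m xx l k *m t0).
      by rewrite !mulmxDl -!scalemxAl scalerBr opprD addrACA.
    exact: inA_lin.
  case: (eqVneq m l) => [ml|ml]; last first.
    exists 0; split; [exact: inA0 | exact: mul0mx |].
    rewrite !mul0mx subr0; apply/inS; exists (u *m v) => //.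
    by rewrite -um; apply: (ideal_mem HA) => //; rewrite /U' Um.
  rewrite ml in um mv; have [_ _ hxx _ _] := Hxy.
  have vE : corner l k (v *m e k).
    split; first by apply: (RM HA) => //; exact: Re.
      by rewrite mulmxA mv.
    by rewrite -mulmxA (eK HA).
  have [c hc] := hxx l k _ vE.
  exists (c *: u); split; first exact: inAZ.
    by rewrite -scalemxAl um.
  apply/inS; exists (u *m (v *m e k - c *: xx l k)).
    by apply: (ideal_mull HA) => //; exact: (ideal_mono HA aU' hc).
  by rewrite mulmxBr !mulmxBl -!mulmxA kt -!scalemxAl -scalemxAr.
have trivial_step : xx l k *m t0 = 0 -> inF R (iso_Delta R e le) Mat (S U) 0.
  move=> h0; apply: inF_eqmx inF'; apply/andP; split=> //.
  apply: inA_subP => Y /inS[z hz ->]; have [s [_ _]] := dec z hz.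
  by rewrite -mulmxA h0 mulmx0 subr0.
have [_ _ _ _ hz0] := Hxy.
case: (boolP (le k l)) => kl; last by apply: trivial_step; rewrite (hz0 l k kl).1 mul0mx.
case: (boolP (le l i)) => li; last first.
  by apply: trivial_step; have [xR lx _] := xxE l k; rewrite -lx tw.
have [D DK] : exists D, DeltaKer K N R n e le l D.
  by have [_ _ /(_ l l (le_refl Hpo l))[[D [DK _]] _] _ _] := Hq; exists D.
have [sD DP _ _] := DK.
apply: (inF_step (l := l) (sS U) S'S _ inF'); exists D; split=> //.
have [xR lx xk] := xxE l k.
apply: (@iso_param _ _ R Mat Mat _ _ _ _ _ _ (Pmx R e l) (lin_mulmxr (xx l k *m t0)) 1%:M
  (fun X => lin_mulmx X)) => //.
- apply/andP; split.
    rewrite addsmx_sub S'S andbT; apply: inA_subP => Y /inA_mulr[s /(inPmx HA)[hs sl] ->].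
    apply/inS; exists (s *m xx l k); last by rewrite mulmxA.
    by rewrite -sl; apply: (ideal_mem HA).
  apply: inA_subP => Y /inS[z hz ->]; have [s [hs sl hd]] := dec z hz.
  rewrite -(subrK (s *m xx l k *m t0) (z *m t0)) addrC; apply: inAD.
    rewrite /inA; apply: submx_trans (addsmxSl _ _).
    by apply/inA_mulr; exists s; [apply/(inPmx HA) | rewrite mulmxA].
  by rewrite /inA; apply: submx_trans (addsmxSr _ _).
- by rewrite mulmx1; apply/andP; rewrite addsmx_sub submx_refl DP addsmxSl.
- move=> q; rewrite -[q]vec_mxK mulr_act mulmx1; set s := vec_mx q => /(inPmx HA)[hs sl].
  apply/idP/idP => [/inS[z hz hsz]|/(DeltaKerE Hq _ DK)[hs' _]]; last first.
    apply/inS; exists (s *m xx l k); last by rewrite mulmxA.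
    by apply: (ideal_mulr HA) => //; exact: (ideal_mono HA aU' hs').
  apply/(DeltaKerE Hq _ DK); split=> //.
  (* The annihilator of t(i,k) puts s xx(l,k) into the ideal of W. As l is minimal in [U] and l <=
     i, that ideal lies in the one of {not <= l}; modulo the latter, the coefficient of e_b s along
     [yy l b] becomes that of [layer b k l], and must be 0. *)
  pose W m := U' m || ~~ le m i.
  have WI : inA (ideal W) (s *m xx l k).
    rewrite -(subrK (z *m e k) (s *m xx l k)); apply: inAD; last first.
      apply: (ideal_mulr HA); first exact: Re.
      by apply: (ideal_mono HA) hz => m; rewrite /W => ->.
    apply: (@ideal_mono _ _ _ _ _ HA (not_below i)); first by move=> m; rewrite /W orbC => ->.
    apply/(@t_annihilator i k).
    - apply: inAB; first exact: (RM HA).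
      by apply: (RM HA); [exact: (ideal_R HA hz) | exact: Re].
    - by rewrite mulmxBl -!mulmxA xk (eK HA).
    by rewrite mulmxBl -!mulmxA kt hsz subrr.
  apply: sum_corners => b.
  have [_ _ _ hyy _] := Hxy.
  have bsE : corner b l (e b *m s) by exact: corner_left.
  have [c hc] := hyy l b _ bsE.
  case: (boolP (le b l)) => bl; last first.
    by move: hc; rewrite (hz0 l b bl).2 scaler0 subr0.
  case: (eqVneq c 0) => [c0|c0]; first by move: hc; rewrite c0 scale0r subr0.
  have nl : ~~ not_below l l by rewrite negbK le_refl.
  case: (layer_notin Hq Hxy (@upNB l) nl kl bl).
  have h1 : inA (ideal (not_below l)) (e b *m s *m xx l k).
    rewrite -mulmxA; apply: (ideal_mull HA); first exact: Re.
    apply: (ideal_mono HA) WI => m /orP[|mi].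
      move=> /andP[Um ml]; apply: contra ml => ml; apply/eqP; exact: minl.
    by apply: contra mi => ml; exact: (le_trans Hpo ml li).
  have h2 : inA (ideal (not_below l)) ((e b *m s - c *: yy l b) *m xx l k).
    apply: (ideal_mulr HA) => //; apply: (ideal_mono HA) hc => m.
    exact: (above_not_le Hq).
  have := inAZ c^-1 (inAB h1 h2).
  by rewrite mulmxBl opprB addrCA subrr addr0 -scalemxAl scalerA mulVf // scale1r.
- by move=> X hX; exact: Pmx_submod.
- by move=> X _; rewrite -!mulmxA mulmx_mulmxr_comm.
by move=> X _; rewrite !mulmx1.
Qed.

Lemma e_notin_above l : ~ inA (ideal (above le l)) (e l).
Proof.
move=> hI; have [xR lx _] := xxE l l; have [yR _ _] := yyE l l.
have hL := ideal_mull HA yR (ideal_mulr HA xR hI); rewrite lx in hL.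
have nl : ~~ above le l l by rewrite /above eqxx.
exact: (layer_notin Hq Hxy (@above_upset _ _ Hpo l) nl (le_refl Hpo l) (le_refl Hpo l) hL).
Qed.

(** At a step s with maximal label, weights above the label are absent from [U], so the generator x
    of the factor satisfies A x meets [c s] in 0. If s > 0, both are nonzero and contain the simple
    socle of P(j). Hence maximal labels occur only at step 0, and the label there is the
    greatest. *)
Lemma nonzero_label j U : submod R Mat U -> (U <= Pmx R e j)%MS -> U != 0 ->
  inF R (iso_Delta R e le) Mat U 0 -> exists i,
   (forall x m r, ~~ le m i -> inA R r -> inA U x -> e m *m r *m x = 0) /\
   exists2 x, inA U x & e i *m x = x /\ x != 0.
Proof.
move=> sU UP U0 [T [c [lab [c0 cT cs cS]]]].
have cmono s s' : (s <= s')%N -> (s' <= T)%N -> (c s <= c s')%MS.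
  by apply: chain_mono => k /cS[].
have cU s : (s <= T)%N -> (c s <= U)%MS.
  by move=> sT; rewrite -(eqmxP cT); exact: cmono.
have weight m : (forall s, (s < T)%N -> ~~ le m (lab s)) ->
    forall x, inA U x -> e m *m x = 0.
  move=> hm x; rewrite /inA -(eqmxP cT).
  elim: {1 3}T (leqnn T) x => [_ x|s IH sT x hx].
    rewrite (eqmxP c0) submx0 => /eqP h; have -> : x = 0.
      by apply: (can_inj mxvecK); rewrite h linear0.
    by rewrite mulmx0.
  have [css hD] := cS s sT.
  have [D [v [DK vU ve vgen vker]]] := iso_DeltaE HA (Mat_lmod R) (cs s.+1) (cs s) hD.
  have [p hp h] := vgen _ hx.
  have mx : inA (c s) (e m *m x).
    have h1 := (submod_MatP _ _).1 (cs s) (e m) (x - p *m vec_mx v) (Re HA m).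
    rewrite /inA linearB /= -mat_act vec_mxK in h1; have {h1} := h1 h.
    rewrite mulmxBr => h1; rewrite -(subrK (e m *m (p *m vec_mx v)) (e m *m x)).
    apply: inAD => //; rewrite mulmxA /inA -mat_act vec_mxK vker; last first.
      by apply: (RM HA) => //; exact: Re.
    apply: (DeltaKer_weight HA DK (hm s sT)).
    - by apply: (RM HA); [apply: (RM HA) => //; exact: Re | exact: Re].
    - by rewrite !mulmxA (eK HA).
    by rewrite -!mulmxA (eK HA).
  by rewrite -(IH (ltnW sT) _ mx) mulmxA (eK HA).
have T0 : (0 < T)%N.
  rewrite lt0n; apply: contra U0 => /eqP T0; rewrite -submx0.
  by rewrite -(eqmxP c0) -{1}T0 (eqmxP cT).
pose P l := [exists s : 'I_T, lab s == l].
have gen s (sT : (s < T)%N) : (forall l, P l -> le (lab s) l -> l = lab s) ->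
   exists x, [/\ inA (c s.+1) x, e (lab s) *m x = x, x != 0 &
     forall r, inA R r -> inA (c s) (r *m x) -> r *m x = 0].
  move=> hmax; have [_ hD] := cS s sT.
  have [v [vU ve _ vker]] := iso_Delta_gen Hq (Mat_lmod R) (cs s.+1) (cs s) hD.
  have el : e (lab s) *m vec_mx v = vec_mx v.
    by apply: (can_inj mxvecK); rewrite -mat_act vec_mxK.
  have ker r : inA R r -> inA (c s) (r *m vec_mx v) -> r *m vec_mx v = 0.
    move=> hr; rewrite /inA -mat_act vec_mxK => /(vker r hr) hI.
    rewrite -el mulmxA; apply: (ideal_kill HA) hI => m r' lm hr'.
    rewrite -mulmxA; apply: weight.
      move=> s' s'T; apply/negP => ms'; have /andP[lm1 lm2] := lm.
      have hs' : lab s' = lab s.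
        apply: hmax; first by apply/existsP; exists (Ordinal s'T).
        exact: (le_trans Hpo lm2 ms').
      by case/negP: (above_not_le Hq lm); rewrite -hs'.
    apply: (submod_MatP _ _).1 sU _ _ hr' _.
    by apply: inA_sub (cU s.+1 sT) _ _; rewrite /inA vec_mxK.
  exists (vec_mx v); split=> //; first by rewrite /inA vec_mxK.
  apply/eqP => v0.
  have : inA (ideal (above le (lab s))) (1%:M *m e (lab s)).
    by apply/vker; [exact: (R1 HA) | rewrite -(vec_mxK v) v0 linear0 mul0mx sub0mx].
  by rewrite mul1mx; exact: e_notin_above.
have max0 s (sT : (s < T)%N) : (forall l, P l -> le (lab s) l -> l = lab s) -> s = 0%N.
  move=> hmax; have [x [hx lx x0 hker]] := gen s sT hmax.
  apply/eqP; apply: contraT; rewrite -lt0n => s0.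
  have [sg [sg0 _ hsg]] := ex_socle Hq j.
  have inP y : inA U y -> inA R y /\ y *m e j = y.
    by move=> hy; apply/(inPmx HA); exact: inA_sub UP _ hy.
  have [xR xj] := inP _ (inA_sub (cU s.+1 sT) hx).
  have [r hr hrx] := hsg x xR xj x0.
  have [w [wc w0]] : exists w, inA (c s) w /\ w != 0.
    have [_ hD] := cS 0%N T0.
    have [v [vU ve _ vker]] := iso_Delta_gen Hq (Mat_lmod R) (cs 1%N) (cs 0%N) hD.
    exists (vec_mx v); split.
      by rewrite /inA vec_mxK (submx_trans vU) // cmono // ltnW.
    apply/eqP => v0.
    have : inA (ideal (above le (lab 0%N))) (1%:M *m e (lab 0%N)).
      by apply/vker; [exact: (R1 HA) | rewrite -(vec_mxK v) v0 linear0 mul0mx sub0mx].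
    by rewrite mul1mx; exact: e_notin_above.
  have [wR wj] := inP _ (inA_sub (cU s (ltnW sT)) wc).
  have [q hq hqw] := hsg w wR wj w0.
  case/eqP: sg0; rewrite hrx; apply: hker => //; rewrite -hrx hqw.
  exact: (submod_MatP _ _).1 (cs s) _ _ hq wc.
have below s : (s < T)%N -> le (lab s) (lab 0%N).
  move=> sT; have Ps : P (lab s) by apply/existsP; exists (Ordinal sT).
  have [l [/existsP[s' /eqP hs'] sl hl]] := ex_maximal Hpo Ps.
  have s'0 : s' = 0%N :> nat by apply: max0 => // l' Pl'; rewrite hs'; exact: hl.
  by rewrite -s'0 hs'.
exists (lab 0%N); split.
  move=> x m r mi hr hx; rewrite -mulmxA; apply: weight.
    by move=> s sT; apply: contra mi => ms; exact: (le_trans Hpo ms (below s sT)).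
  exact: (submod_MatP _ _).1 sU _ _ hr hx.
have [|x [hx lx x0 _]] := gen 0%N T0.
  by move=> l /existsP[s /eqP <-] h; exact: (le_anti Hpo (below _ (ltn_ord s)) h).
by exists x => //; exact: inA_sub (cU 1%N T0) _ hx.
Qed.

(** Modulo I_{>i} the only way from weight i to the socle is [yy i bot]. If r killed u but not
    t(i,k), comparing two ways to the socle of P(1), from r t(i,k) and from xx(i,k) t(i,k), would
    show that [yy i bot *m xx i k] kills u. Then the socle of P(j) could not be reached from the
    nonzero vector [xx i k *m u]. *)
Lemma local_annihilator j u : u != 0 -> inA R u -> u *m e j = u ->
  forall i k, e k *m u = u ->
  (forall m r, ~~ le m i -> inA R r -> e m *m r *m u = 0) ->
  (exists2 r, inA R r & e i *m r *m u != 0) ->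
  le k i /\ forall r, inA R r -> r *m e k = r -> r *m u = 0 <-> r *m t i k = 0.
Proof.
move=> u0 uR uj i k ku uw [r0 hr0 r0u].
have killI r : inA (ideal (not_below i)) r -> r *m u = 0 by apply: (ideal_kill HA).
have aboveI r : inA (ideal (above le i)) r -> inA (ideal (not_below i)) r.
  by apply: (ideal_mono HA) => m; exact: (above_not_le Hq).
have [_ _ hxx hyy hz] := Hxy.
have [xR ix xk] := xxE i k.
have xu0 : xx i k *m u != 0.
  have [c hc] := hxx i k _ (corner_cut HA i k hr0).
  have := killI _ (aboveI _ hc); rewrite mulmxBl -!mulmxA ku !mulmxA => /eqP.
  rewrite subr_eq0 => /eqP h; apply: contra r0u => /eqP xu.
  by rewrite h -scalemxAl xu scaler0.
have ki : le k i by apply: contraR xu0 => ki; rewrite (hz i k ki).1 mul0mx.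
split=> // r hr rk; split=> h; last first.
  by apply: killI; exact/(t_annihilator _ hr rk).
apply/eqP; apply: contraT => rt0.
have [tR kt tb] := tE i k.
have [s [s0 bs hs]] := ex_socle Hq bot.
have [r1 hr1 hs1] : exists2 r1, inA R r1 & s = r1 *m (r *m t i k).
  by apply: hs => //; [exact: (RM HA) | rewrite -mulmxA tb].
have [s1 hs1R hs2] : exists2 s1, inA R s1 & s = s1 *m (xx i k *m t i k).
  by apply: hs; [exact: (RM HA) | rewrite -mulmxA tb | exact: xx_t].
have hI : inA (ideal (not_below i)) (r1 *m r - s1 *m xx i k).
  apply/(@t_annihilator i k).
  - by apply: inAB; exact: (RM HA).
  - by rewrite mulmxBl -!mulmxA rk xk.
  by rewrite mulmxBl -!mulmxA -hs1 -hs2 subrr.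
have s1u : s1 *m xx i k *m u = 0.
  have := killI _ hI; rewrite mulmxBl -(mulmxA r1) h mulmx0 sub0r => /eqP.
  by rewrite oppr_eq0 => /eqP.
have [c1 hc1] := hyy i bot _ (corner_cut HA bot i hs1R).
have expand (q : 'M[K]_N) c : inA (ideal (above le i)) (e bot *m q *m e i - c *: yy i bot) ->
    forall z : 'M[K]_N, (forall y, inA (ideal (not_below i)) y -> y *m z = 0) -> e i *m z = z ->
    e bot *m (q *m z) = c *: (yy i bot *m z).
  move=> hq z hz' iz; have := hz' _ (aboveI _ hq).
  rewrite mulmxBl -!mulmxA iz -scalemxAl => /eqP; rewrite subr_eq0 => /eqP -> //.
have zt y : inA (ideal (not_below i)) y -> y *m (xx i k *m t i k) = 0.
  move=> hy; rewrite mulmxA; move: (ideal_mulr HA xR hy); apply: (ideal_kill HA) => m q.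
  exact: tw.
have zu y : inA (ideal (not_below i)) y -> y *m (xx i k *m u) = 0.
  by move=> hy; rewrite mulmxA; apply: killI; exact: (ideal_mulr HA xR hy).
have e1 : e bot *m (s1 *m (xx i k *m t i k)) = c1 *: (yy i bot *m (xx i k *m t i k)).
  by apply: expand; rewrite // mulmxA ix.
have e2 : e bot *m (s1 *m (xx i k *m u)) = c1 *: (yy i bot *m (xx i k *m u)).
  by apply: expand; rewrite // mulmxA ix.
have c10 : c1 != 0.
  by apply: contra s0 => /eqP c0; rewrite -bs hs2 e1 c0 scale0r.
have yxu : yy i bot *m (xx i k *m u) = 0.
  have /eqP := e2; rewrite (mulmxA s1) s1u mulmx0 eq_sym scaler_eq0 (negPf c10).
  by move/eqP.
have [sj [sj0 bsj hsj]] := ex_socle Hq j.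
have [s2 hs2R hs3] : exists2 s2, inA R s2 & sj = s2 *m (xx i k *m u).
  by apply: hsj; [exact: (RM HA) | rewrite -mulmxA uj | ].
have [c2 hc2] := hyy i bot _ (corner_cut HA bot i hs2R).
have e3 : e bot *m (s2 *m (xx i k *m u)) = c2 *: (yy i bot *m (xx i k *m u)).
  by apply: expand; rewrite // mulmxA ix.
by case/eqP: sj0; rewrite -bsj hs3 e3 yxu scaler0.
Qed.

Lemma cyclic_iso k a b u v : inA R u -> inA R v -> e k *m u = u -> e k *m v = v ->
  u *m e a = u -> v *m e b = v ->
  (forall r, inA R r -> r *m e k = r -> r *m u = 0 <-> r *m v = 0) ->
  iso R Mat (Amul R u) 0 Mat (Amul R v) 0.
Proof.
move=> uR vR ku kv ua vb huv.
have gen w : e k *m w = w -> (Pmx R e k *m lin_mulmxr w + (0 : 'M_(N * N)) == Amul R w)%MS.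
  move=> kw; apply/eqmxP; apply: eqmx_trans (addsmx0 _ _) _; apply/eqmxP/andP; split.
    apply: inA_subP => Y /inA_mulr[s /(inPmx HA)[hs _] ->].
    by apply/inAmul; exists s.
  apply: inA_subP => Y /inAmul[s hs ->]; apply/inA_mulr; exists (s *m e k).
    apply/(inPmx HA); rewrite -mulmxA (eK HA); split=> //.
    by apply: (RM HA) => //; exact: Re.
  by rewrite -mulmxA kw.
apply: (@iso_param _ _ R Mat Mat _ _ _ _ _ _ (Pmx R e k) (lin_mulmxr u) (lin_mulmxr v)
  (fun X => lin_mulmx X)).
- exact: gen.
- exact: gen.
- move=> q; rewrite -[q]vec_mxK !mulr_act !submx0; set s := vec_mx q => /(inPmx HA)[hs sk].
  have z (y : 'M[K]_N) : (mxvec y == 0) = (y == 0).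
    apply/eqP/eqP => [h|->]; last exact: linear0.
    by apply: (can_inj mxvecK); rewrite h linear0.
  by rewrite !z; apply/eqP/eqP => /(huv s hs sk).
- by move=> X hX; exact: (Pmx_submod HA).
- by move=> X _; rewrite -!mulmxA mulmx_mulmxr_comm.
- by move=> X _; rewrite -!mulmxA mulmx_mulmxr_comm.
- exact: zero_submod.
exact: zero_submod.
Qed.

Lemma local_filtered_generator j U : submod R Mat U -> (U <= Pmx R e j)%MS ->
  local_sq R Mat U 0 -> inF R (iso_Delta R e le) Mat U 0 ->
  exists i k u, [/\ le k i, (U == Amul R u)%MS, corner k j u,
    (forall m r, ~~ le m i -> inA R r -> e m *m r *m u = 0) &
    iso R Mat U 0 Mat (Amul R (t i k)) 0].
Proof.
move=> sU UP hloc hF.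
have U0 : U != 0.
  have [V [_ [_ [[VU _] _]]]] := hloc.
  by apply/eqP => h; move: VU; rewrite h ltmx0.
have [i [hw [x xU [ix x0]]]] := nonzero_label sU UP U0 hF.
have [k [u [uU ku Ugen]]] := local_generated HA sU hloc.
have Uu : (U == Amul R u)%MS.
  rewrite /eqmx Ugen /=; apply: inA_subP => y /inAmul[r hr ->].
  exact: (submod_MatP _ _).1 sU _ _ hr uU.
have /(inPmx HA)[uR uj] : inA (Pmx R e j) u by exact: inA_sub UP _ uU.
have u0 : u != 0.
  apply: contra U0 => /eqP h; rewrite -submx0; apply: submx_trans Ugen _.
  by apply: inA_subP => y /inAmul[r _ ->]; rewrite h mulmx0; exact: inA0.
have uw m r : ~~ le m i -> inA R r -> e m *m r *m u = 0 by move=> mi hr; exact: hw.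
have [ki hann] : le k i /\ forall r, inA R r -> r *m e k = r -> r *m u = 0 <-> r *m t i k = 0.
  apply: (local_annihilator u0 uR uj ku uw).
  have /inAmul[r hr hx] : inA (Amul R u) x by exact: inA_sub Ugen _ xU.
  by exists r => //; rewrite -mulmxA -hx ix.
exists i, k, u; split=> //.
have [tR kt tb] := tE i k.
apply: (@iso_eqmx _ _ _ Mat Mat (Amul R u) 0); last exact: (cyclic_iso uR tR ku kt uj tb hann).
  by apply/eqmxP/eqmx_sym/eqmxP.
by rewrite submx_refl.
Qed.

Lemma local_filtered_iso j U : submod R Mat U -> (U <= Pmx R e j)%MS ->
  local_sq R Mat U 0 -> inF R (iso_Delta R e le) Mat U 0 ->
  exists i k, le k i /\ iso R Mat U 0 Mat (Amul R (t i k)) 0.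
Proof.
move=> sU UP hl hF; have [i [k [u [ki _ _ _ h]]]] := local_filtered_generator sU UP hl hF.
by exists i, k.
Qed.

Lemma iso_rank (M1 M2 : amod K N) (U1 : 'M[K]_(mdim M1)) (U2 : 'M[K]_(mdim M2)) :
  iso R M1 U1 0 M2 U2 0 -> (\rank U2 <= \rank U1)%N.
Proof.
case=> f [/eqmxP h _ _]; rewrite -h addsmx0.
exact: mxrankM_maxl.
Qed.

(** Inside P(1), [t_cover] turns the isomorphism into an inclusion between modules of equal
    dimension. *)
Lemma local_filtered_eq U : submod R Mat U -> (U <= Pmx R e bot)%MS ->
  local_sq R Mat U 0 -> inF R (iso_Delta R e le) Mat U 0 ->
  exists i k, le k i /\ (U == Amul R (t i k))%MS.
Proof.
move=> sU UP hl hF; have [i [k [u [ki hu uE uw hiso]]]] := local_filtered_generator sU UP hl hF.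
exists i, k; split=> //.
have ut : inA (Amul R (t i k)) u by exact: t_cover.
have Ut : (U <= Amul R (t i k))%MS.
  rewrite (eqmxP hu); apply: inA_subP => y /inAmul[r hr ->].
  exact: (submod_MatP _ _).1 (Amul_submod HA _) _ _ hr ut.
by rewrite /eqmx Ut /=; have /mxrank_leqif_sup/geq_leqif <- := Ut; exact: iso_rank hiso.
Qed.

End TiltingFamily.

(* A = the unital subalgebra of 'M[K]_N encoded by R, with vertex idempotents
   e (trivial paths), partial order le on Q_0 = 'I_n, smallest vertex bot
   (= "1") and largest vertex top (= "n").  T i = the tilting modules, J the
   radical, lam k / alpha k the vertices / arrows of the fixed path
   p(1,k,k), t1 i = t(i,1).  t i k = t(i,k) = p(1,k,k) . t(i,1). *)
Theorem theorem3p1 (K : closedFieldType) (N n : nat) (R : 'M[K]_(N * N))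
  (e : 'I_n -> 'M[K]_N) (le : rel 'I_n) (bot top : 'I_n)
  (T : 'I_n -> amod K N) (J : 'M[K]_(N * N))
  (lam : 'I_n -> seq 'I_n) (alpha : 'I_n -> seq 'M[K]_N)
  (t1 : 'I_n -> 'M[K]_N) :
  one_qh R e le bot top ->
  (forall i, is_lmod R (T i) /\ is_tilting R e le (T i) 1%:M 0 i) ->
  one_qh (ringel_alg R T) (ringel_idem T) (fun a b => le b a) top bot ->
  rad_decomp R e J ->
  (forall k, [/\ path (covers le) bot (lam k), last bot (lam k) = k,
                 size (alpha k) = size (lam k) &
                 forall s, (s < size (lam k))%N ->
                   arrow e J (nth bot (bot :: lam k) s) (nth bot (lam k) s)
                             (nth 0 (alpha k) s)]) ->
  (forall i, [/\ inA R (t1 i), e bot *m t1 i *m e bot = t1 i &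
                 iso R Mat (Amul R (t1 i)) 0 (T i) 1%:M 0]) ->
  let t i k := pathmx e bot (alpha k) *m t1 i in
  let P1 := Pmx R e bot in
  [/\ (* (1) the t(i,k), k <= i, form a K-basis of P(1) *)
      (forall i k, le k i -> inA P1 (t i k)) /\
      (forall c : 'I_n -> 'I_n -> K,
         \sum_(i < n) \sum_(k < n | le k i) c i k *: t i k = 0 ->
         forall i k, le k i -> c i k = 0) /\
      (forall X, inA P1 X -> exists c : 'I_n -> 'I_n -> K,
         X = \sum_(i < n) \sum_(k < n | le k i) c i k *: t i k),
      (* (2) the A t(i,k) are exactly the local submodules of P(1) in F(Delta) *)
      (forall i k, le k i ->
         [/\ submod R Mat (Amul R (t i k)), (Amul R (t i k) <= P1)%MS,
             local_sq R Mat (Amul R (t i k)) 0 &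
             inF R (iso_Delta R e le) Mat (Amul R (t i k)) 0]) /\
      (forall U, submod R Mat U -> (U <= P1)%MS -> local_sq R Mat U 0 ->
         inF R (iso_Delta R e le) Mat U 0 ->
         exists i k, le k i /\ (U == Amul R (t i k))%MS),
      (* (2) moreover: local submodules of any P(j) in F(Delta) *)
      (forall j U, submod R Mat U -> (U <= Pmx R e j)%MS -> local_sq R Mat U 0 ->
         inF R (iso_Delta R e le) Mat U 0 ->
         exists i k, le k i /\ iso R Mat U 0 Mat (Amul R (t i k)) 0) &
      (* (3) endomorphisms of P(1) preserve every A t(i,k) *)
      (forall F : 'M[K]_(N * N), (P1 *m F <= P1)%MS ->
         (forall X, inA R X -> P1 *m (mact Mat X *m F - F *m mact Mat X) = 0) ->
         forall i k, le k i -> (Amul R (t i k) *m F <= Amul R (t i k))%MS)].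
Proof.
move=> Hq HT _ HJ Hpath Ht1 t P1.
have HA : basic_alg R e by case: Hq => -[].
have Hpo : partial_order n le by case: Hq => -[_ []].
have [xx [yy Hxy]] := ex_layer_generators Hq.
pose p k := pathmx e bot (alpha k).
have hp k : corner R e k bot (p k) /\ xx top k *m p k != 0.
  have [h1 h2 h3 h4] := Hpath k.
  by have := pathmx_corner Hq Hxy HJ h1 h3 h4; rewrite h2.
have t1E i : corner R e bot bot (t1 i).
  by have [hR <- _] := Ht1 i; exact: corner_cut.
have tE i k : corner R e k bot (t i k) by exact: (corner_mul HA) (hp k).1 (t1E i).
have tw i k m r : ~~ le m i -> inA R r -> e m *m r *m t i k = 0.
  move=> mi hr; have [_ ht] := HT i; have [_ _ hiso] := Ht1 i.
  rewrite /t mulmxA -(mulmxA (e m)); apply: (tilting_weight Hq ht hiso mi).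
  by apply: (RM HA) => //; case: (hp k).1.
(* Membership in the ideal is reflected by right multiplication with p(1,k,k), so the annihilator of
   t(i,1) determines that of t(i,k). *)
have tann i k b r : corner R e b k r -> r *m t i k = 0 ->
    inA (ideal R e (fun m => ~~ le m i)) r.
  move=> hr; rewrite /t mulmxA => h0.
  have [hM ht] := HT i; have [_ _ hiso] := Ht1 i.
  have hrp : corner R e b bot (r *m p k) by exact: (corner_mul HA) hr (hp k).1.
  apply: (path_mul_ideal Hq Hxy (fun k => (hp k).1) (fun k => (hp k).2) _ hr).
    exact: not_below_upset.
  exact: (tilting_annihilator Hq Hxy hM ht (t1E i) hiso hrp h0).
split.
- split; first by move=> i k _; apply/(inPmx HA); case: (tE i k).
  split=> [c|X]; first exact: (t_family_independent Hq Hxy tE tw tann).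
  exact: (t_family_span Hq Hxy tE tw tann).
- split=> [i k ki|U sU UP hl hF]; last exact: (local_filtered_eq Hq Hxy tE tw tann).
  have [tR kt tb] := tE i k; split.
  + exact: (Amul_submod HA).
  + apply: inA_subP => Y /inAmul[r hr ->]; apply/(inPmx HA).
    by rewrite -mulmxA tb; split=> //; exact: (RM HA).
  + exact: (Amul_local HA HJ kt (t_neq0 Hq Hxy tann ki)).
  exact: (t_filtered Hq Hxy tE tw tann).
- by move=> j U sU UP hl hF; exact: (local_filtered_iso Hq Hxy tE tw tann sU UP hl hF).
by move=> F FP Fact i k ki; exact: (t_invariant Hq Hxy tE tw tann FP Fact ki).
Qed.
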